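(* Let $G$ be a simply connected five dimensional nilpotent Lie group with a left invariant Riemannian metric $\tilde a$, whose Lie algebra $\mathfrak l_{5,9}$ has an $\tilde a$-orthonormal basis $\{E_1,\dots,E_5\}$ with non-zero brackets $[E_1,E_2]=kE_3+lE_4+mE_5$, $[E_1,E_3]=pE_4$, $[E_2,E_3]=qE_5$, where either $k>0$, $q>p>0$ and $l,m\ge0$, or $k,p>0$, $l\ge0$, $m=0$ and $q=p$. Let $F(x,y)=\sqrt{\tilde a(y,y)}+\tilde a(X(x),y)$ be a Randers metric of Douglas type on $G$, where $X$ is a left invariant vector field with $\sqrt{\tilde a(X,X)}<1$. Then a non-zero vector $Y=y_1E_1+y_2E_2+y_3E_3+y_4E_4+y_5E_5$ is a geodesic vector of $(G,F)$ if and only if one of the following holds: $Y\in\operatorname{span}\{E_3\}$; or $Y\in\operatorname{span}\{E_4,E_5\}$; or $Y\in\operatorname{span}\{E_2,E_3,E_4\}$ and $y_2(ky_3+ly_4)+py_3y_4=0$; or $Y$ is not orthogonal to $E_1$ and $$\begin{cases} y_1(ky_3+ly_4+my_5)-qy_3y_5=0,\\ p\,y_1y_4+q\,y_2y_5=0.\end{cases}$$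
   Context: Brackets of basis elements not listed (and not obtained by antisymmetry) are zero. Orthogonality is with respect to $\tilde a$. The spray coefficients of $F$ in standard local coordinates $(x,y)$ of the tangent bundle are $G^i=\frac14 g^{ij}\big([F^2]_{x^ry^j}y^r-[F^2]_{x^j}\big)$, where $g_{ij}=\frac12\frac{\partial^2F^2}{\partial y^i\partial y^j}$. $F$ is of Douglas type if in every standard local coordinate system $G^i=\frac12\Gamma^i_{jr}(x)y^jy^r+P(x,y)y^i$ for some functions $\Gamma^i_{jr}(x)$ and some local function $P(x,y)$ positively homogeneous of degree one in $y$. A non-zero vector $Y$ of the Lie algebra is a geodesic vector of $(G,F)$ if the curve $t\mapsto\exp(tY)$ is a geodesic of $(G,F)$. *)

(* Defs.v *)
From HB Require Import structures.
From mathcomp Require Import all_boot all_order all_algebra.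
From mathcomp Require Import all_classical all_reals all_analysis.

Set Implicit Arguments.
Unset Strict Implicit.
Unset Printing Implicit Defensive.

Import Order.TTheory GRing.Theory Num.Theory.
Import numFieldNormedType.Exports.

Local Open Scope classical_set_scope.
Local Open Scope ring_scope.

(* No compatibility between the two structures is built in: see [lie_group]. *)
#[short(type="groupTopologicalType")]
HB.structure Definition GroupTopological := {G of Group G & Topological G}.

(* To be used on an open set [D] of a finite dimensional [V], where this is
   the usual C^k regularity. *)
Fixpoint Ck (R : realType) (V W : normedModType R) (k : nat) (D : set V)
    (f : V -> W) : Prop :=
  match k with
  | 0 => forall x, D x -> {for x, continuous f}
  | j.+1 => (forall x, D x -> differentiable f x) /\
            (forall v, Ck j D ('D_v f))
  end.

Definition smooth_on (R : realType) (V W : normedModType R) (D : set V)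
    (f : V -> W) : Prop :=
  forall k, Ck k D f.

Definition simply_connected (R : realType) (T : topologicalType) : Prop :=
  (forall x y : T, exists c : R -> T,
     [/\ {within `[0, 1], continuous c}, c 0 = x & c 1 = y]) /\
  (forall c : R -> T, {within `[0, 1], continuous c} -> c 0 = c 1 ->
     exists H : R * R -> T,
       [/\ {within `[0, 1] `*` `[0, 1], continuous H},
           forall s, s \in `[0, 1] -> H (s, 0) = c s /\ H (s, 1) = c 0 &
           forall t, t \in `[0, 1] -> H (0, t) = c 0 /\ H (1, t) = c 0]).

(* A chart is a pair of total functions; only their restrictions to the open
   sets [dom] and [cod] are meaningful. *)
Record chart (R : realType) (n : nat) (M : topologicalType) := Chart {
  dom : set M;
  cod : set 'rV[R]_n;
  to_coord :> M -> 'rV[R]_n;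
  from_coord : 'rV[R]_n -> M
}.

Section Charts.
Context {R : realType} {n : nat} {M : topologicalType}.
Implicit Types phi psi : chart R n M.

Definition is_chart phi : Prop :=
  [/\ open (dom phi), open (cod phi),
      forall p, dom phi p ->
        [/\ cod phi (phi p), from_coord phi (phi p) = p &
            {for p, continuous phi}] &
      forall x, cod phi x ->
        [/\ dom phi (from_coord phi x), phi (from_coord phi x) = x &
            {for x, continuous (from_coord phi)}]].

Definition smooth_transition phi psi : Prop :=
  smooth_on (cod phi `&` from_coord phi @^-1` dom psi)
            (psi \o from_coord phi).

Definition compatible phi psi : Prop :=
  smooth_transition phi psi /\ smooth_transition psi phi.

End Charts.

(* An [n]-dimensional smooth manifold: the maximal atlas, that is, the set of
   all local coordinate systems, and a preferred chart around each point. The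
   tangent space at [p] is 'rV_n, the vector [v] standing for the tangent
   vector at [p] whose components in the chart [chart_at p] are [v]. *)
Record smooth_structure (R : realType) (n : nat) (M : topologicalType) :=
  SmoothStructure {
    atlas : set (chart R n M);
    chart_at : M -> chart R n M;
    manifold_hausdorff : hausdorff_space M;
    manifold_second_countable : @second_countable M;
    atlas_chart : forall phi, atlas phi -> is_chart phi;
    atlas_compatible : forall phi psi, atlas phi -> atlas psi ->
      compatible phi psi;
    atlas_maximal : forall phi, is_chart phi ->
      (forall psi, atlas psi -> compatible phi psi) -> atlas phi;
    atlas_chart_at : forall p, atlas (chart_at p);
    dom_chart_at : forall p, dom (chart_at p) p
  }.

Section Manifold.
Context {R : realType} {n : nat} {M : topologicalType}.
Variable S : smooth_structure R n M.
Implicit Types (phi : chart R n M) (p : M) (X Y : M -> 'rV[R]_n).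

(* components in [phi] of the tangent vector [v] at [p] *)
Definition components phi p (v : 'rV[R]_n) : 'rV[R]_n :=
  'd (phi \o from_coord (chart_at S p)) (chart_at S p p) v.

(* the tangent vector at [from_coord phi x] with components [y] in [phi] *)
Definition of_components phi (x y : 'rV[R]_n) : 'rV[R]_n :=
  'd (chart_at S (from_coord phi x) \o from_coord phi) x y.

Definition tangent_map (f : M -> M) p (v : 'rV[R]_n) : 'rV[R]_n :=
  'd (chart_at S (f p) \o f \o from_coord (chart_at S p))
     (chart_at S p p) v.

Definition field_in phi X (x : 'rV[R]_n) : 'rV[R]_n :=
  components phi (from_coord phi x) (X (from_coord phi x)).

Definition smooth_field X : Prop :=
  forall phi, atlas S phi -> smooth_on (cod phi) (field_in phi X).

Definition lie_bracket X Y : M -> 'rV[R]_n := fun p =>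
  let phi := chart_at S p in
  'd (field_in phi Y) (phi p) (X p) - 'd (field_in phi X) (phi p) (Y p).

Definition smooth_curve (c : R -> M) : Prop :=
  continuous c /\
  forall phi, atlas S phi -> smooth_on [set t | dom phi (c t)] (phi \o c).

Definition velocity (c : R -> M) (t : R) : 'rV[R]_n :=
  derive1 (chart_at S (c t) \o c) t.

Definition riemannian_metric (a : M -> 'rV[R]_n -> 'rV[R]_n -> R) : Prop :=
  [/\ forall p u v, a p u v = a p v u,
      forall p (s : R) u v w, a p (s *: u + v) w = s * a p u w + a p v w,
      forall p u, u != 0 -> 0 < a p u u &
      forall phi u v, atlas S phi ->
        smooth_on (cod phi) (fun x =>
          a (from_coord phi x) (of_components phi x u) (of_components phi x v))].

Section Finsler.
Variable F : M -> 'rV[R]_n -> R.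

Definition finsler_in phi (x y : 'rV[R]_n) : R :=
  F (from_coord phi x) (of_components phi x y).

Local Notation e i := (delta_mx (0 : 'I_1) (i : 'I_n) : 'rV[R]_n).

Definition fundamental_tensor phi (x y : 'rV[R]_n) : 'M[R]_n :=
  \matrix_(i, j) (2^-1 *
    'D_(e i) (fun z => 'D_(e j) (fun w => finsler_in phi x w ^+ 2) z) y).

Definition spray_coefficient phi (i : 'I_n) (x y : 'rV[R]_n) : R :=
  4^-1 * \sum_j invmx (fundamental_tensor phi x y) i j *
    (\sum_r 'D_(e j) (fun w =>
         'D_(e r) (fun z => finsler_in phi z w ^+ 2) x) y * y 0 r
     - 'D_(e j) (fun z => finsler_in phi z y ^+ 2) x).

(* The spray coefficients are defined away from the zero section only. *)
Definition douglas_type : Prop :=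
  forall phi, atlas S phi ->
  exists (Gamma : 'I_n -> 'I_n -> 'I_n -> 'rV[R]_n -> R)
         (P : 'rV[R]_n -> 'rV[R]_n -> R),
    (forall x y (s : R), cod phi x -> y != 0 -> 0 < s ->
       P x (s *: y) = s * P x y) /\
    (forall x y i, cod phi x -> y != 0 ->
       spray_coefficient phi i x y =
         2^-1 * (\sum_j \sum_r Gamma i j r x * y 0 j * y 0 r)
         + P x y * y 0 i).

Definition geodesic (c : R -> M) : Prop :=
  [/\ smooth_curve c,
      forall t, velocity c t != 0 &
      forall phi t i, atlas S phi -> dom phi (c t) ->
        derive1n 2 (phi \o c) t 0 i
        + 2 * spray_coefficient phi i (phi (c t)) (derive1 (phi \o c) t) = 0].

End Finsler.

Definition randers (a : M -> 'rV[R]_n -> 'rV[R]_n -> R) X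
    : M -> 'rV[R]_n -> R :=
  fun p v => Num.sqrt (a p v v) + a p (X p) v.

Definition in_span (s : seq (M -> 'rV[R]_n)) Y : Prop :=
  exists c : nat -> R, Y = \sum_(i < size s) c i *: s`_i.

End Manifold.

Section LieGroup.
Context {R : realType} {n : nat} {G : groupTopologicalType}.
Variable S : smooth_structure R n G.
Implicit Types (X Y : G -> 'rV[R]_n) (a : G -> 'rV[R]_n -> 'rV[R]_n -> R).

Definition lie_group : Prop :=
  [/\ continuous (fun z : G * G => (z.1 * z.2)%g),
      continuous (fun g : G => (g^-1)%g),
      forall phi1 phi2 psi, atlas S phi1 -> atlas S phi2 -> atlas S psi ->
        let mul (z : 'rV[R]_n * 'rV[R]_n) :=
          (from_coord phi1 z.1 * from_coord phi2 z.2)%g in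
        smooth_on ((cod phi1 `*` cod phi2) `&` mul @^-1` dom psi)
          (psi \o mul) &
      forall phi psi, atlas S phi -> atlas S psi ->
        let inv (x : 'rV[R]_n) := ((from_coord phi x)^-1)%g in
        smooth_on (cod phi `&` inv @^-1` dom psi) (psi \o inv)].

(* The Lie algebra of [G] is the space of left invariant vector fields. *)
Definition left_invariant_field X : Prop :=
  smooth_field S X /\
  forall g p : G, tangent_map S (fun h => (g * h)%g) p (X p) = X (g * p)%g.

(* [G] is nilpotent of class at most [k] when all the brackets
   [X_1, [X_2, ... [X_k, Z]]] vanish. *)
Definition nilpotent_lie_group : Prop :=
  exists k : nat, forall (Xs : seq (G -> 'rV[R]_n)) (Z : G -> 'rV[R]_n),
    size Xs = k -> (forall i, (i < k)%N -> left_invariant_field Xs`_i) ->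
    left_invariant_field Z -> foldr (lie_bracket S) Z Xs = 0.

Definition left_invariant_metric a : Prop :=
  riemannian_metric S a /\
  forall (g p : G) u v,
    let L := tangent_map S (fun h => (g * h)%g) p in
    a (g * p)%g (L u) (L v) = a p u v.

(* For a left invariant metric, the inner product of two left invariant fields
   does not depend on the point where it is taken. *)
Definition lie_dot a X Y : R := a 1%g (X 1%g) (Y 1%g).

Definition orthonormal_basis a (s : seq (G -> 'rV[R]_n)) : Prop :=
  [/\ forall i, (i < size s)%N -> left_invariant_field s`_i,
      forall X, left_invariant_field X -> in_span s X &
      forall i j, (i < size s)%N -> (j < size s)%N ->
        lie_dot a s`_i s`_j = (i == j)%:R].

Definition one_parameter_subgroup (c : R -> G) Y : Prop :=
  [/\ smooth_curve S c, forall s t, c (s + t) = (c s * c t)%g &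
      velocity S c 0 = Y (c 0)].

(* The values of [expG] outside the Lie algebra are irrelevant; on it, [expG]
   is determined by this property, since expG Y is the value at 1 of the
   one-parameter subgroup generated by Y. *)
Definition exponential_map (expG : (G -> 'rV[R]_n) -> G) : Prop :=
  forall Y, left_invariant_field Y ->
    one_parameter_subgroup (fun t => expG (t *: Y)) Y.

Definition geodesic_vector (F : G -> 'rV[R]_n -> R)
    (expG : (G -> 'rV[R]_n) -> G) Y : Prop :=
  [/\ left_invariant_field Y, Y <> 0 &
      geodesic S F (fun t => expG (t *: Y))].

End LieGroup.

(* Main.v *)
Require Import Defs.
From HB Require Import structures.
From mathcomp Require Import all_boot all_order all_algebra.
From mathcomp Require Import all_classical all_reals all_analysis.
From mathcomp Require Import ring lra.

Set Implicit Arguments.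
Unset Strict Implicit.
Unset Printing Implicit Defensive.

Import Order.TTheory GRing.Theory Num.Theory.
Import numFieldNormedType.Exports.

Local Open Scope classical_set_scope.
Local Open Scope ring_scope.

(* In the left invariant orthonormal frame the Randers metric is one and the
   same function |h| + c.h of the frame components h. In any chart its
   Euler-Lagrange equation along a field of constant frame components h reads
     Hess(F^2)(h)(u, W(h)) = - d(F^2)(h)([h, u])   for all u,
   where W(h) is twice the spray plus the acceleration of the integral curves.
   If the metric is of Douglas type, then W(h) is even in h up to a multiple of
   h; comparing the equation at h and -h gives c.[h, u] = 0. Then
   t |-> exp(t h) is a geodesic iff W(h) = 0 iff h.[h, u] = 0 for all u, which
   amounts to three polynomial equations. *)

(** * Directional derivatives *)

Section DirectionalDerivative.
Context {R : realType} {V : normedModType R}.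

(** The spray depends on the chart, whereas a bracket does not. The bridge is that [F] seen in the
    frame no longer depends on the point: every position derivative in the spray falls on the
    coframe, and differentiating the relation between frame and coframe turns these into derivatives
    of the frame. The bound |c| < 1 makes the norm positive and the Hessian of its square definite;
    definiteness is what recovers W(h) from its pairings with all u. An obstacle lies in the
    encoding of tangent vectors. A tangent vector at p is stored by its components in a preferred
    chart at p, which need not vary continuously with p. Fields and brackets therefore have to be
    transported into one fixed chart before they are differentiated; for the bracket this rests on
    the symmetry of the second derivatives of the transition maps, proved here by second
    differences. When y1 is non-zero, one of the three final equations follows from the other two,
    which is why only two of them appear in the fourth case of the theorem. *)

Lemma is_derive_comp1 (g : V -> R) (h : R -> R) (x v : V) (dg dh : R) :
  is_derive x v g dg -> is_derive (g x) 1 h dh ->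
  is_derive x v (h \o g) (dh * dg).
Proof.
move=> [g_dvbl g_val] [h_dvbl h_val].
(* Only the derivative of [g] along [v] is given, so [g] is restricted to the line through [x],
   where the one-variable chain rule applies. *)
have line0 : (fun t : R => g (t *: v + x)) 0 = g x by rewrite scale0r add0r.
have gl : derivable (fun t : R => g (t *: v + x)) 0 1.
  exact: (derivable1P _ _ _).1.
have lineD (f : V -> R) : 'D_v f x = derive1 (fun t : R => f (t *: v + x)) 0.
  rewrite /derive1 /derive.
  set g1 := (X in lim (X @ _) = _); set g2 := (X in _ = lim (X @ _)).
  suff -> : g1 = g2 by [].
  by apply/funext => t; rewrite /g1 /g2 /= addr0 scale0r add0r.
split.
  apply/derivable1P; apply/derivable1_diffP.
  apply: (@differentiable_comp _ _ _ _ (fun t : R => g (t *: v + x)) h).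
    exact/derivable1_diffP.
  by rewrite line0; exact: (derivable1_diffP _ _).1.
rewrite lineD.
rewrite (_ : (fun t => _) = h \o (fun t : R => g (t *: v + x)))//.
rewrite derive1_comp; [|exact: gl|rewrite line0; exact: h_dvbl].
by rewrite line0 derive1E h_val -lineD g_val.
Qed.

Lemma is_derive_mxE {m n : nat} (M : V -> 'M[R]_(m, n)) (x v : V)
    (dM : 'M[R]_(m, n)) i j :
  is_derive x v M dM -> is_derive x v (fun z => M z i j) (dM i j).
Proof.
move=> [M_dvbl <-]; apply: DeriveDef; first exact: (derivable_mxP _ _ _).1.
by rewrite derive_mx// mxE.
Qed.

Lemma is_derive_mx {m n : nat} (M : V -> 'M[R]_(m, n)) (x v : V)
    (dM : 'M[R]_(m, n)) :
  (forall i j, is_derive x v (fun z => M z i j) (dM i j)) -> is_derive x v M dM.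
Proof.
move=> Mij; have M_dvbl : derivable M x v by apply/derivable_mxP => i j.
split=> //; apply/matrixP => i j; rewrite derive_mx// mxE.
by have [_ ->] := Mij i j.
Qed.

Lemma is_derive_mulmx {m n p : nat} (A : V -> 'M[R]_(m, n))
    (B : V -> 'M[R]_(n, p)) (x v : V) (dA : 'M[R]_(m, n))
    (dB : 'M[R]_(n, p)) :
  is_derive x v A dA -> is_derive x v B dB ->
  is_derive x v (fun z => A z *m B z) (dA *m B x + A x *m dB).
Proof.
move=> dAx dBx; apply: is_derive_mx => i j.
rewrite (_ : (fun z => _) =
    \sum_l ((fun z => A z i l) * (fun z => B z l j))); last first.
  by apply/funext => z; rewrite mxE fct_sumE.
have dA' l := is_derive_mxE i l dAx; have dB' l := is_derive_mxE l j dBx.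
apply: is_derive_eq.
rewrite !mxE -big_split/=; apply: eq_bigr => l _.
by rewrite /GRing.scale/= addrC mulrC [B x l j * _]mulrC.
Qed.

End DirectionalDerivative.

(** * The Euclidean inner product on row vectors *)

Section Dot.
Context {R : realType} {n : nat}.
Implicit Types u v w : 'rV[R]_n.

Definition dot u v : R := (u *m v^T) 0 0.

Lemma dotE u v : dot u v = \sum_i u 0 i * v 0 i.
Proof. by rewrite /dot mxE; apply: eq_bigr => i _; rewrite mxE. Qed.

Lemma dotC u v : dot u v = dot v u.
Proof. by rewrite !dotE; apply: eq_bigr => i _; rewrite mulrC. Qed.

Lemma dotDr u v w : dot u (v + w) = dot u v + dot u w.
Proof. by rewrite /dot linearD mulmxDr mxE. Qed.

Lemma dotZr s u v : dot u (s *: v) = s * dot u v.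
Proof. by rewrite /dot linearZ -scalemxAr mxE. Qed.

Lemma dotDl u v w : dot (v + w) u = dot v u + dot w u.
Proof. by rewrite dotC dotDr !(dotC u). Qed.

Lemma dotZl s u v : dot (s *: u) v = s * dot u v.
Proof. by rewrite dotC dotZr dotC. Qed.

Lemma dotNr u v : dot u (- v) = - dot u v.
Proof. by rewrite -scaleN1r dotZr mulN1r. Qed.

Lemma dotNl u v : dot (- u) v = - dot u v.
Proof. by rewrite -scaleN1r dotZl mulN1r. Qed.

Lemma dot0l u : dot 0 u = 0.
Proof. by rewrite /dot mul0mx mxE. Qed.

Lemma dot0r u : dot u 0 = 0.
Proof. by rewrite dotC dot0l. Qed.

Lemma dot_ge0 u : 0 <= dot u u.
Proof. by rewrite dotE; apply: sumr_ge0 => i _; rewrite -expr2 sqr_ge0. Qed.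

Lemma dot_eq0 u : (dot u u == 0) = (u == 0).
Proof.
apply/idP/eqP => [|->]; last by rewrite dot0l.
rewrite dotE psumr_eq0 => [|i _]; last by rewrite -expr2 sqr_ge0.
move=> /allP u0; apply/rowP => i; rewrite mxE.
have /implyP := u0 i (mem_index_enum i).
by rewrite mulf_eq0 orbb => /(_ isT)/eqP.
Qed.

Lemma dot_gt0 u : u != 0 -> 0 < dot u u.
Proof. by move=> u0; rewrite lt_neqAle dot_ge0 eq_sym dot_eq0 u0. Qed.

Lemma cauchy_schwarz u v : dot u v ^+ 2 <= dot u u * dot v v.
Proof.
have [->|u0] := eqVneq u 0; first by rewrite !dot0l mul0r expr0n.
(* The squared length of this vector is [dot u u] times the gap in the inequality. *)
have := dot_ge0 (dot u u *: v - dot u v *: u).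
rewrite !(dotDr, dotDl, dotNr, dotNl, dotZr, dotZl) (dotC v u).
have := dot_gt0 u0; nra.
Qed.

Lemma is_derive_dot (V : normedModType R) (a b : V -> 'rV[R]_n) (x v : V)
    (da db : 'rV[R]_n) :
  is_derive x v a da -> is_derive x v b db ->
  is_derive x v (fun z => dot (a z) (b z)) (dot da (b x) + dot (a x) db).
Proof.
move=> dax dbx.
have dbT : is_derive x v (fun z => (b z)^T) db^T.
  apply: is_derive_mx => i j; rewrite mxE.
  rewrite (_ : (fun z => _) = fun z => b z j i); first exact: is_derive_mxE.
  by apply/funext => z; rewrite mxE.
apply: is_derive_eq; first exact/is_derive_mxE/is_derive_mulmx.
by rewrite mxE.
Qed.

End Dot.

(** * The Randers norm on a Euclidean space *)

Section RandersNorm.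
Context {R : realType} {n : nat}.
Variable c : 'rV[R]_n.
Hypothesis c_lt1 : dot c c < 1.
Implicit Types u v w h : 'rV[R]_n.

Definition enorm h : R := Num.sqrt (dot h h).

Definition rnorm h : R := enorm h + dot c h.

(* [covec h] is the differential of [rnorm] at [h], [angular h] the Hessian of
   [enorm], [dsq h] and [hess h] the differential and the Hessian of
   [rnorm ^+ 2]. *)
Definition covec h := (enorm h)^-1 *: h + c.

Definition angular h u v : R :=
  (enorm h)^-1 * dot u v - (enorm h)^-1 ^+ 3 * (dot h u * dot h v).

Definition hess h u v : R :=
  2 * (dot (covec h) u * dot (covec h) v + rnorm h * angular h u v).

Definition dsq h u : R := 2 * rnorm h * dot (covec h) u.

Lemma enorm_gt0 h : h != 0 -> 0 < enorm h.
Proof. by move=> h0; rewrite sqrtr_gt0 dot_gt0. Qed.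

Lemma enorm_sqr h : enorm h ^+ 2 = dot h h.
Proof. by rewrite sqr_sqrtr // dot_ge0. Qed.

Lemma enormN h : enorm (- h) = enorm h.
Proof. by rewrite /enorm dotNl dotNr opprK. Qed.

(** Since |c| < 1, Cauchy-Schwarz bounds [dot c h] strictly by [enorm h] in absolute value, so the
    linear term cannot outweigh the norm. *)
Lemma rnorm_gt0 h : h != 0 -> 0 < rnorm h.
Proof.
move=> h0; have N0 := enorm_gt0 h0.
have := cauchy_schwarz c h; rewrite -(enorm_sqr h) /rnorm => CS.
have lt : dot c h ^+ 2 < enorm h ^+ 2.
  by apply: (le_lt_trans CS); rewrite gtr_pMl// exprn_gt0.
have : `|dot c h| < enorm h.
  by rewrite -(ltr_pXn2r (n := 2)) ?nnegrE ?(ltW N0)// real_normK ?num_real.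
by rewrite ltr_norml; lra.
Qed.

(** Euler's identity for a function homogeneous of degree one. *)
Lemma covec_self h : h != 0 -> dot (covec h) h = rnorm h.
Proof.
move=> /enorm_gt0 /lt0r_neq0 N0.
by rewrite dotDl dotZl -enorm_sqr expr2 mulKf.
Qed.

Lemma angularC h u v : angular h u v = angular h v u.
Proof. by rewrite /angular dotC (mulrC (dot h u)). Qed.

Lemma angularDr h u v w : angular h u (v + w) = angular h u v + angular h u w.
Proof. by rewrite /angular !dotDr; ring. Qed.

Lemma angularZr h s u v : angular h u (s *: v) = s * angular h u v.
Proof. by rewrite /angular !dotZr; ring. Qed.

Lemma angularN h u v : angular (- h) u v = angular h u v.
Proof. by rewrite /angular enormN !dotNl; ring. Qed.

(** The Hessian of a function homogeneous of degree one annihilates the radial direction. This is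
    what later removes the multiple of [h] in the Douglas condition. *)
Lemma angular_self h u : h != 0 -> angular h u h = 0.
Proof.
move=> /enorm_gt0 /lt0r_neq0 N0.
by rewrite /angular -enorm_sqr (dotC h u); field.
Qed.

Lemma hessC h u v : hess h u v = hess h v u.
Proof. by rewrite /hess angularC (mulrC (dot _ u)). Qed.

Lemma hessDr h u v w : hess h u (v + w) = hess h u v + hess h u w.
Proof. by rewrite /hess angularDr dotDr; ring. Qed.

Lemma hessZr h s u v : hess h u (s *: v) = s * hess h u v.
Proof. by rewrite /hess angularZr dotZr; ring. Qed.

Lemma dsqDr h u v : dsq h (u + v) = dsq h u + dsq h v.
Proof. by rewrite /dsq dotDr mulrDr. Qed.

Lemma dsqZr h s u : dsq h (s *: u) = s * dsq h u.
Proof. by rewrite /dsq dotZr mulrCA. Qed.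

Lemma dsqNr h u : dsq h (- u) = - dsq h u.
Proof. by rewrite -scaleN1r dsqZr mulN1r. Qed.

Lemma hess_sumr h u (I : Type) (r : seq I) (s : I -> R) (v : I -> 'rV[R]_n) :
  hess h u (\sum_(i <- r) s i *: v i) = \sum_(i <- r) s i * hess h u (v i).
Proof.
elim: r => [|i r IH]; first by rewrite !big_nil -(scale0r 0) hessZr mul0r.
by rewrite !big_cons hessDr hessZr IH.
Qed.

(** Both summands of [hess h v v] are nonnegative, so both vanish. For the second this is the
    equality case of Cauchy-Schwarz, which makes [v] a multiple of [h]; the first then excludes a
    non-zero multiple, because [covec h] takes the positive value [rnorm h] at [h]. *)
Lemma hess_eq0 h v : h != 0 -> hess h v v = 0 -> v = 0.
Proof.
move=> h0; have N0 := enorm_gt0 h0; have f0 := rnorm_gt0 h0.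
have CS : dot h v ^+ 2 <= enorm h ^+ 2 * dot v v.
  by rewrite enorm_sqr cauchy_schwarz.
set i := (enorm h)^-1; have iN : i * enorm h = 1 by rewrite mulVf ?gt_eqF.
have i0 : 0 < i by rewrite invr_gt0.
have angE : angular h v v =
    i ^+ 3 * (enorm h ^+ 2 * dot v v - dot h v ^+ 2).
  transitivity (i * (i * enorm h) ^+ 2 * dot v v - i ^+ 3 * dot h v ^+ 2).
    by rewrite iN expr1n mulr1 /angular -/i -expr2.
  by ring.
have ang0 : 0 <= angular h v v.
  by rewrite angE mulr_ge0 ?exprn_ge0 ?subr_ge0// ltW.
rewrite /hess => /eqP; rewrite mulf_eq0 pnatr_eq0/= paddr_eq0; first last.
- by rewrite mulr_ge0// ltW.
- by rewrite -expr2 sqr_ge0.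
rewrite mulf_eq0 orbb mulf_eq0 (gt_eqF f0)/= => /andP[/eqP cv0 /eqP].
rewrite angE => /eqP; rewrite mulf_eq0 expf_eq0 (gt_eqF i0)/= subr_eq0.
move=> /eqP CSE.
have u0 : dot h h *: v - dot h v *: h = 0.
  apply/eqP; rewrite -dot_eq0; apply/eqP.
  rewrite !(dotDr, dotDl, dotNr, dotNl, dotZr, dotZl) (dotC v h) -(enorm_sqr h).
  transitivity (enorm h ^+ 2 * (enorm h ^+ 2 * dot v v - dot h v ^+ 2)).
    by ring.
  by rewrite CSE subrr mulr0.
have hv0 : dot h v = 0.
  have := congr1 (dot (covec h)) u0.
  rewrite dotDr dotNr !dotZr cv0 mulr0 add0r dot0r covec_self// => /eqP.
  by rewrite oppr_eq0 mulf_eq0 (gt_eqF f0) orbF => /eqP.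
apply/eqP; move/eqP: u0; rewrite hv0 scale0r subr0 scaler_eq0.
by rewrite (gt_eqF (dot_gt0 h0)).
Qed.

Section Derivatives.
Variables (V : normedModType R) (x v : V) (a : V -> 'rV[R]_n) (da : 'rV[R]_n).
Hypotheses (a_da : is_derive x v a da) (ax0 : a x != 0).

Lemma is_derive_enorm :
  is_derive x v (fun z => enorm (a z)) ((enorm (a x))^-1 * dot (a x) da).
Proof.
apply: is_derive_eq.
  apply: (is_derive_comp1 (h := Num.sqrt)) (is_derive_dot a_da a_da) _.
  by apply: is_derive1_sqrt; exact: dot_gt0.
rewrite -/(enorm _) (dotC da) -mulr2n -[X in _ * X]mulr_natl invfM.
by rewrite mulrACA mulVf ?pnatr_eq0// mul1r.
Qed.

Lemma is_derive_rnorm :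
  is_derive x v (fun z => rnorm (a z)) (dot (covec (a x)) da).
Proof.
apply: is_derive_eq.
  have dc := is_derive_dot (is_derive_cst c x v) a_da.
  exact: (is_deriveD is_derive_enorm dc).
by rewrite dot0l add0r dotDl dotZl.
Qed.

Lemma is_derive_sqr_rnorm :
  is_derive x v (fun z => rnorm (a z) ^+ 2)
    (dsq (a x) da).
Proof.
rewrite (_ : (fun z => _) =
    (fun z => rnorm (a z)) * (fun z => rnorm (a z))); last first.
  by apply/funext => z; rewrite expr2.
apply: is_derive_eq; first exact: (is_deriveM is_derive_rnorm is_derive_rnorm).
by rewrite /dsq /GRing.scale/=; ring.
Qed.

Lemma is_derive_covec :
  is_derive x v (fun z => covec (a z))
    ((enorm (a x))^-1 *: da
     - ((enorm (a x))^-1 ^+ 3 * dot (a x) da) *: a x).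
Proof.
have N0 := enorm_gt0 ax0.
have dN := is_derive_enorm.
have dNV : is_derive x v (fun z => (enorm (a z))^-1)
    (- (enorm (a x))^-1 ^+ 3 * dot (a x) da).
  split; first by apply: derivableV => //; rewrite gt_eqF.
  rewrite deriveV ?gt_eqF// derive_val /GRing.scale/= -exprVn; ring.
apply: is_derive_mx => i j; rewrite ord1.
rewrite (_ : (fun z => _) =
    (fun z => (enorm (a z))^-1) * (fun z => a z 0 j) + cst (c 0 j)); last first.
  by apply/funext => z; rewrite !mxE.
have daj := is_derive_mxE 0 j a_da.
apply: is_derive_eq.
by rewrite !mxE /GRing.scale/=; ring.
Qed.

(** Both arguments may vary: the mixed derivative in the spray coefficients differentiates [dsq] at
    a vector depending on the fibre variable, applied to another such vector. *)
Lemma is_derive_dsq (b : V -> 'rV[R]_n) (db : 'rV[R]_n) :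
  is_derive x v b db ->
  is_derive x v (fun z => dsq (a z) (b z))
    (hess (a x) da (b x) + dsq (a x) db).
Proof.
move=> b_db.
rewrite (_ : (fun z => _) = 2 \*: ((fun z => rnorm (a z)) *
    (fun z => dot (covec (a z)) (b z)))); last first.
  by apply/funext => z; rewrite /dsq -mulrA.
have dr := is_derive_rnorm.
have dd := is_derive_dot is_derive_covec b_db.
apply: (is_derive_eq (is_deriveZ 2 (is_deriveM dr dd))).
rewrite /hess /dsq /angular dotDl dotNl !dotZl /GRing.scale/=; ring.
Qed.

End Derivatives.

End RandersNorm.

(** * Symmetry of second derivatives *)

Section NearDiff.
Context {R : realType} {V W : normedModType R}.
Implicit Types (f g : V -> W) (x v : V).

Lemma differentiable_eps f x : differentiable f x ->
  forall e : R, 0 < e ->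
  \forall w \near 0, `|f (w + x) - f x - 'd f x w| <= e * `|w|.
Proof.
move=> /diff_locally/eqaddoP fo e e0; near=> w.
suff -> : f (w + x) - f x - 'd f x w =
    ((f \o shift x) - (cst (f x) + 'd f x)) w by near: w; exact: fo.
by rewrite -addrA -opprD.
Unshelve. all: by end_near. Qed.

(** Charts are total functions whose identities hold on open sets only, so derivatives are
    transferred by locality: the continuous linear map ['d f x] also gives the first order expansion
    of [g]. *)
Lemma near_eq_is_diff f g x : (\near x, f x = g x) -> differentiable f x ->
  differentiable g x /\ 'd g x = 'd f x :> (V -> W).
Proof.
move=> fg df; have gx : g x = f x by rewrite (nbhs_singleton fg).
have fg0 : \forall w \near 0, f (w + x) = g (w + x).
  move: fg; rewrite (near_shift 0 x)/=.
  by apply: filterS => w; rewrite /= subr0.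
have dgE : g \o shift x = cst (g x) + 'd f x +o_ 0 id.
  apply/eqaddoP => e e0; near=> w.
  suff -> : (g \o shift x - (cst (g x) + 'd f x)) w =
      f (w + x) - f x - 'd f x w.
    by near: w; exact: differentiable_eps.
  transitivity (g (w + x) - (g x + 'd f x w)) => //.
  by rewrite gx opprD addrA (near fg0).
have dg := diff_unique (diff_continuous df) dgE.
split=> //; apply/diff_locallyP; split.
  by rewrite dg; exact: diff_continuous.
by rewrite dg.
Unshelve. all: by end_near. Qed.

Lemma near_eq_differentiable f g x :
  (\near x, f x = g x) -> differentiable f x -> differentiable g x.
Proof. by move=> fg /(near_eq_is_diff fg)[]. Qed.

Lemma near_eq_diff f g x : (\near x, f x = g x) -> differentiable f x ->
  'd g x = 'd f x :> (V -> W).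
Proof. by move=> fg /(near_eq_is_diff fg)[]. Qed.

Lemma is_derive_diff f x v : differentiable f x -> is_derive x v f ('d f x v).
Proof. by split; [exact: diff_derivable | exact: deriveE]. Qed.

Lemma is_derive_line f (u b : V) (s : R) : differentiable f (s *: u + b) ->
  is_derive s 1 (fun t => f (t *: u + b)) ('D_u f (s *: u + b)).
Proof.
move=> df; split.
  apply/derivable1_diffP.
  by apply: (@differentiable_comp _ _ _ _ (fun t : R => t *: u + b) f).
rewrite /derive; set g1 := (X in lim (X @ _) = _).
set g2 := (X in _ = lim (X @ _)).
suff -> : g1 = g2 by [].
by apply/funext => t; rewrite /g1 /g2 /= scalerDl addrA [t *: 1]mulr1.
Qed.

End NearDiff.

Section Schwarz.
Context {R : realType} {V : normedModType R}.

Definition second_difference (f : V -> R) (x u v : V) (h : R) :=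
  f (h *: u + (h *: v + x)) - f (h *: u + x) - f (h *: v + x) + f x.

(* Mean value theorem for [s |-> f (s u + h v + x) - f (s u + x)] on [0, h]. *)
Lemma second_difference_eps (f : V -> R) (x u v : V) :
  (\forall z \near x, differentiable f z) -> differentiable ('D_u f) x ->
  forall e : R, 0 < e -> \forall h \near 0^'+,
  `|second_difference f x u v h - h ^+ 2 * 'D_v ('D_u f) x| <= e * h ^+ 2.
Proof.
(* The expansion of ['D_u f] is used at two points, each time with error at most
   [e / C * (h * (|u| + |v|))]. As [C] exceeds twice [|u| + |v|], the errors add up to at most
   [e * h]; the summand 1 keeps [C] positive when [u] and [v] vanish. *)
move=> df dDuf e e0; set C := 2 * (`|u| + `|v|) + 1.
have C0 : 0 < C by rewrite ltr_wpDl// mulr_ge0// addr_ge0.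
have eC0 : 0 < e / C by rewrite divr_gt0.
have /nbhs_ballP[d d0 dE] := differentiable_eps dDuf eC0.
have /nbhs_ballP[d' d'0 d'E] := df.
near=> h; have h0 : 0 < h by near: h; exact: nbhs_right_gt.
have hC : h * C < Num.min d d'.
  rewrite -ltr_pdivlMr//; near: h; apply: nbhs_right_lt.
  by rewrite divr_gt0// lt_min d0.
have [hd hd'] : h * C < d /\ h * C < d' by move: hC; rewrite lt_min => /andP.
(* The boolean distinguishes the line through [h *: v + x] from the one through [x], so that both
   are estimated at once. *)
have bound s (b : bool) : 0 <= s <= h ->
    `|s *: u + (b%:R * h) *: v| <= h * (`|u| + `|v|).
  move=> /andP[s0 sh]; rewrite (le_trans (ler_normD _ _))// mulrDr lerD//.
    by rewrite normrZ ger0_norm// ler_wpM2r.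
  rewrite normrZ ger0_norm ?mulr_ge0 ?(ltW h0)// ler_wpM2r//.
  by rewrite ler_piMl ?(ltW h0)//; case: b.
have lt_C : h * (`|u| + `|v|) < h * C.
  rewrite ltr_pM2l// /C; have := addr_ge0 (normr_ge0 u) (normr_ge0 v); lra.
have diff_at s (b : bool) : 0 <= s <= h ->
    differentiable f (s *: u + ((b%:R * h) *: v + x)).
  move=> sh; apply: d'E; rewrite -ball_normE/= addrA opprD addrCA subrr addr0.
  by rewrite normrN (le_lt_trans (bound _ _ sh))// (lt_trans lt_C).
pose g (b : bool) s := f (s *: u + ((b%:R * h) *: v + x)).
have dg b s : 0 <= s <= h -> is_derive s 1 (g b)
    ('D_u f (s *: u + ((b%:R * h) *: v + x))).
  by move=> sh; apply: is_derive_line; exact: diff_at.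
have dgg s : 0 <= s <= h -> is_derive s 1 (g true - g false)
    ('D_u f (s *: u + ((1 * h) *: v + x)) -
     'D_u f (s *: u + ((0 * h) *: v + x))).
  by move=> sh; apply: is_deriveB; exact: dg.
have cgg : {within `[0, h], continuous (g true - g false)}.
  apply: derivable_within_continuous => s; rewrite in_itv/= => /dgg[].
  by [].
have [|s] := @MVT _ (g true - g false) (fun s =>
    'D_u f (s *: u + ((1 * h) *: v + x)) -
    'D_u f (s *: u + ((0 * h) *: v + x))) 0 h h0 _ cgg.
  by move=> s; rewrite in_itv/= => /andP[s0 sh]; apply: dgg; rewrite !ltW.
rewrite in_itv/= => /andP[s0 sh].
rewrite subr0 => ggE.
have sh' : 0 <= s <= h by rewrite !ltW.
have in_ball (b : bool) : ball 0 d (s *: u + (b%:R * h) *: v).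
  rewrite -ball_normE/= sub0r normrN.
  by rewrite (le_lt_trans (bound _ _ sh'))// (lt_trans lt_C).
have est (b : bool) := dE _ (in_ball b).
(* The two increments share [s *: u], so the unknown intermediate value [s] drops out of the
   difference of the linear terms. *)
have lin : 'd ('D_u f) x (s *: u + (true%:R * h) *: v) -
    'd ('D_u f) x (s *: u + (false%:R * h) *: v) = h * 'D_v ('D_u f) x.
  rewrite deriveE// !linearD !linearZ/=.
  by rewrite mul1r mul0r scale0r addr0 scalerN addrAC subrr add0r.
rewrite [X in `|X - _|](_ : _ = (g true - g false) h - (g true - g false) 0);
    last first.
  rewrite /second_difference /g -![(_ - _ : _ -> _) _]/(_ - _).
  by rewrite !(mul1r, mul0r, scale0r, add0r); ring.
rewrite ggE.
have eCh : e / C * (h * (`|u| + `|v|)) * 2 <= e * h.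
  rewrite -mulrA [X in _ * X](_ : _ = h * (2 * (`|u| + `|v|))); last by ring.
  rewrite mulrCA mulrC ler_pM2r// -mulrA ler_piMr ?(ltW e0)//.
  by rewrite ler_pdivrMl// mulr1 lerDl.
have est' (b : bool) := le_trans (est b)
  (ler_wpM2l (ltW eC0) (bound s b sh')).
have := est' true; have := est' false.
move: lin eCh; set A1 := 'D_u f (s *: u + ((1 * h) *: v + x)).
set A0 := 'D_u f (s *: u + ((0 * h) *: v + x)).
rewrite -!(addrA _ _ x) -/A1 -/A0.
set L1 := 'd _ _ (_ + (true%:R * h) *: _).
set L0 := 'd _ _ (_ + (false%:R * h) *: _).
set B := e / C * _; move=> lin eCh est0 est1.
rewrite [X in `|X| <= _](_ : _ = h * (A1 - A0 - (L1 - L0))).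
  rewrite [leRHS](_ : _ = h * (e * h)); last by ring.
  rewrite normrM (gtr0_norm h0) ler_pM2l//.
  move: est0 est1; rewrite !ler_norml => /andP[l0 u0] /andP[l1 u1].
  by apply/andP; split; lra.
by rewrite lin; ring.
Unshelve. all: by end_near. Qed.

Lemma second_differenceC (f : V -> R) (x u v : V) (h : R) :
  second_difference f x v u h = second_difference f x u v h.
Proof. by rewrite /second_difference addrCA; congr (_ + _); rewrite addrAC. Qed.

(** The second difference is symmetric in [u] and [v], and divided by [h ^+ 2] it tends to each of
    the two mixed derivatives. *)
Lemma derive_comm (f : V -> R) (x u v : V) :
  (\forall z \near x, differentiable f z) ->
  differentiable ('D_u f) x -> differentiable ('D_v f) x ->
  'D_v ('D_u f) x = 'D_u ('D_v f) x.
Proof.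
move=> df dDu dDv.
apply/eqP; rewrite -subr_eq0 -normr_le0.
apply/ler_addgt0Pl => e e0; rewrite addr0.
have e20 : 0 < e / 2 by rewrite divr_gt0.
have near_uv := second_difference_eps v df dDu e20.
have near_vu := second_difference_eps u df dDv e20.
have [h [h0 Dh]] :=
  filter_ex (filterI (nbhs_right_gt 0) (filterI near_uv near_vu)).
move: Dh => /= -[]; rewrite (second_differenceC f x u v).
have h20 : 0 < h ^+ 2 by rewrite exprn_gt0.
move: ('D_v _ x) ('D_u _ x) (h ^+ 2) h20 (second_difference _ _ _ _ _).
move=> A B h2 h20 D.
rewrite ler_norml => /andP[l1 u1]; rewrite ler_norml => /andP[l2 u2].
rewrite ler_norml; apply/andP; split; rewrite -(ler_pM2r h20); lra.
Qed.

Lemma derive_comm_rV n (f : V -> 'rV[R]_n) (x u v : V) :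
  (\forall z \near x, differentiable f z) ->
  differentiable ('D_u f) x -> differentiable ('D_v f) x ->
  'D_v ('D_u f) x = 'D_u ('D_v f) x.
Proof.
move=> df dDu dDv; have coordE w j :
    \forall z \near x, 'D_w f z 0 j = 'D_w (fun z => f z 0 j) z.
  near=> z; rewrite derive_mx ?mxE//.
  by apply: diff_derivable; near: z.
have diffE w j : differentiable ('D_w f) x ->
    differentiable ('D_w (fun z => f z 0 j)) x.
  move=> dDw; apply: near_eq_differentiable (coordE w j) _.
  exact: (differentiable_comp dDw (differentiable_coord _ 0 j)).
have derE w w' j : differentiable ('D_w f) x ->
    'D_w' ('D_w f) x 0 j = 'D_w' ('D_w (fun z => f z 0 j)) x.
  move=> dDw; rewrite derive_mx ?mxE; last exact: diff_derivable.
  exact/near_eq_derive/coordE.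
apply/rowP => j.
apply: etrans (derE u v j dDu) (etrans _ (esym (derE v u j dDv))).
apply: derive_comm (diffE u j dDu) (diffE v j dDv).
near=> z; have dfz : differentiable f z by near: z.
exact: (differentiable_comp dfz (differentiable_coord _ 0 j)).
Unshelve. all: by end_near. Qed.

End Schwarz.

(** * The spray in a moving frame *)

Section SprayInFrame.
Context {R : realType} {n : nat} {M : topologicalType}.
Variables (S : smooth_structure R n M) (F : M -> 'rV[R]_n -> R).
Variables (phi : chart R n M) (c : 'rV[R]_n).
Hypothesis c_lt1 : dot c c < 1.
(** Row [i] of [E z] holds the chart components of the [i]-th frame field at [z]; right
    multiplication by [Theta z] turns chart components into frame components. *)
Variables (E Theta : 'rV[R]_n -> 'M[R]_n) (x : 'rV[R]_n).
Hypothesis F_frame : \forall z \near x,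
  forall w, finsler_in S F phi z w = rnorm c (w *m Theta z).
Hypothesis E_Theta : \forall z \near x, E z *m Theta z = 1%:M.
Hypothesis E_diff : differentiable E x.
Hypothesis Theta_diff : differentiable Theta x.
Implicit Types (u v w y h : 'rV[R]_n).

Local Notation e i := (delta_mx (0 : 'I_1) (i : 'I_n) : 'rV[R]_n).

Let ETx : E x *m Theta x = 1%:M. Proof. exact: nbhs_singleton E_Theta. Qed.

Let TEx : Theta x *m E x = 1%:M. Proof. exact: mulmx1C. Qed.

Let Theta_neq0 w : w != 0 -> w *m Theta x != 0.
Proof.
apply: contra_neq => w0.
by rewrite -[w]mulmx1 -TEx mulmxA w0 mul0mx.
Qed.

Let row_coord m (A : 'M[R]_(n, m)) w : w *m A = \sum_i w 0 i *: (e i *m A).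
Proof.
by rewrite {1}(row_sum_delta w) mulmx_suml; under eq_bigr do rewrite -scalemxAl.
Qed.

Let is_derive_mulr (A : 'M[R]_n) w v : is_derive w v (mulmx^~ A) (v *m A).
Proof.
apply: is_derive_eq.
  exact: (is_derive_mulmx (is_derive_id w v) (is_derive_cst A w v)).
by rewrite mulmx0 addr0.
Qed.

Let near_neq0 w : w != 0 -> \forall z \near w, z != 0.
Proof.
exact: (@cvgr_neq0 _ _ _ (nbhs w) _ id w).
Qed.

Lemma fundamental_tensor_frame i j y : y != 0 ->
  fundamental_tensor S F phi x y i j
  = 2^-1 * hess c (y *m Theta x) (e i *m Theta x) (e j *m Theta x).
Proof.
move=> y0; rewrite mxE; congr (_ * _).
have Fx : (fun w => finsler_in S F phi x w ^+ 2) =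
          (fun w => rnorm c (w *m Theta x) ^+ 2).
  by apply/funext => w; rewrite (nbhs_singleton F_frame).
rewrite Fx (@near_eq_derive _ _ _ _
    (fun z => dsq c (z *m Theta x) (e j *m Theta x))); last first.
  near=> z; have z0 : z != 0 by near: z; exact: near_neq0.
  by have [_ ->] :=
    is_derive_sqr_rnorm c (is_derive_mulr _ z (e j)) (Theta_neq0 z0).
have [_ ->] := is_derive_dsq c (is_derive_mulr _ y (e i)) (Theta_neq0 y0)
  (is_derive_cst (e j *m Theta x) _ _).
by rewrite -(scale0r 0) dsqZr mul0r addr0.
Unshelve. all: by end_near. Qed.

Lemma fundamental_tensor_form u v y : y != 0 ->
  (u *m fundamental_tensor S F phi x y *m v^T) 0 0
  = 2^-1 * hess c (y *m Theta x) (u *m Theta x) (v *m Theta x).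
Proof.
move=> y0; rewrite (row_coord (Theta x) u) hessC hess_sumr mulr_sumr.
rewrite -mulmxA mxE; apply: eq_bigr => i _.
rewrite hessC (row_coord (Theta x) v) hess_sumr mxE !mulr_sumr.
apply: eq_bigr => j _.
by rewrite fundamental_tensor_frame// mxE; ring.
Qed.

(** [invmx] returns a singular matrix unchanged, so the definition of the spray coefficients is
    meaningful only where this holds. It follows from the definiteness of [hess]. *)
Lemma fundamental_tensor_unit y : y != 0 ->
  fundamental_tensor S F phi x y \in unitmx.
Proof.
move=> y0; rewrite -row_free_unit; apply: inj_row_free => v vg0.
have := fundamental_tensor_form v v y0; rewrite vg0 mul0mx mxE => /esym/eqP.
rewrite mulf_eq0 invr_eq0 pnatr_eq0/= => /eqP/(hess_eq0 c_lt1 (Theta_neq0 y0)).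
by move=> vT0; rewrite -[v]mulmx1 -TEx mulmxA vT0 mul0mx.
Qed.

Let derive_finsler w v : w != 0 ->
  'D_v (fun z => finsler_in S F phi z w ^+ 2) x
  = dsq c (w *m Theta x) (w *m 'd Theta x v).
Proof.
move=> w0.
rewrite (@near_eq_derive _ _ _ _ (fun z => rnorm c (w *m Theta z) ^+ 2)).
  have dT : is_derive x v Theta ('d Theta x v).
    by split; [exact: diff_derivable | exact: deriveE].
  have [_ ->] := is_derive_sqr_rnorm c
    (is_derive_mulmx (is_derive_cst w x v) dT) (Theta_neq0 w0).
  by rewrite mul0mx add0r.
by apply: filterS F_frame => z ->.
Qed.

Let dsq_suml h (I : Type) (r : seq I) (s : I -> R) (V : I -> 'rV[R]_n) :
  dsq c h (\sum_(i <- r) s i *: V i) = \sum_(i <- r) s i * dsq c h (V i).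
Proof.
elim: r => [|i r IH]; first by rewrite !big_nil -(scale0r 0) dsqZr mul0r.
by rewrite !big_cons dsqDr dsqZr IH.
Qed.

Definition spray y : 'rV[R]_n := \row_i spray_coefficient S F phi i x y.

(** Lowering the index of the spray with the fundamental tensor removes the inverse matrix and
    leaves an identity of forms in [u], in which the position derivatives of [F] are derivatives of
    [Theta]. *)
Lemma spray_frame y u : y != 0 ->
  2 * hess c (y *m Theta x) (u *m Theta x) (spray y *m Theta x)
  = hess c (y *m Theta x) (u *m Theta x) (y *m 'd Theta x y)
    + dsq c (y *m Theta x) (u *m 'd Theta x y)
    - dsq c (y *m Theta x) (y *m 'd Theta x u).
Proof.
move=> y0; set h := y *m Theta x.
(* [B j] is the parenthesis in the definition of the spray coefficients, so [4^-1 * B j] is the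
   spray with lowered index. *)
pose B j : R := \sum_r 'D_(e j) (fun w =>
         'D_(e r) (fun z => finsler_in S F phi z w ^+ 2) x) y * y 0 r
     - 'D_(e j) (fun z => finsler_in S F phi z y ^+ 2) x.
have BE j : B j = hess c h (e j *m Theta x) (y *m 'd Theta x y)
    + dsq c h (e j *m 'd Theta x y) - dsq c h (y *m 'd Theta x (e j)).
  rewrite /B derive_finsler//; congr (_ - _).
  have dxy r : 'D_(e j) (fun w =>
      'D_(e r) (fun z => finsler_in S F phi z w ^+ 2) x) y =
      hess c h (e j *m Theta x) (y *m 'd Theta x (e r))
      + dsq c h (e j *m 'd Theta x (e r)).
    rewrite (@near_eq_derive _ _ _ _
       (fun w => dsq c (w *m Theta x) (w *m 'd Theta x (e r)))); last first.
      near=> w; apply: derive_finsler; near: w; exact: near_neq0.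
    by have [_ ->] := is_derive_dsq c (is_derive_mulr _ y (e j)) (Theta_neq0 y0)
      (is_derive_mulr ('d Theta x (e r)) y (e j)).
  have dTy : 'd Theta x y = \sum_r y 0 r *: 'd Theta x (e r).
    rewrite {1}(row_sum_delta y) linear_sum.
    by under eq_bigr do rewrite linearZ.
  rewrite dTy !mulmx_sumr; under [in RHS]eq_bigr do rewrite -scalemxAr.
  under [in X in _ = _ + X]eq_bigr do rewrite -scalemxAr.
  rewrite hess_sumr dsq_suml// -big_split/=; apply: eq_bigr => r _.
  by rewrite dxy; ring.
have gG : fundamental_tensor S F phi x y *m (spray y)^T = \col_j (4^-1 * B j).
  rewrite (_ : (spray y)^T =
      invmx (fundamental_tensor S F phi x y) *m \col_j (4^-1 * B j)).
    by rewrite mulKVmx// fundamental_tensor_unit.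
  apply/colP => i; rewrite !mxE /spray_coefficient mulr_sumr.
  apply: eq_bigr => j _.
  by rewrite [in RHS]mxE mulrCA.
have := fundamental_tensor_form u (spray y) y0.
(* The factor 4 clears the quarter of the spray; against the half in the fundamental tensor it
   leaves the 2 of the statement. *)
rewrite -/h -mulmxA gG mxE => /(congr1 ( *%R 4)).
rewrite mulrA (_ : 4 * 2^-1 = 2 :> R); last by field.
move=> <-; rewrite mulr_sumr.
rewrite (row_coord (Theta x) u) hessC hess_sumr.
rewrite (row_coord ('d Theta x y) u) dsq_suml//.
rewrite (_ : 'd Theta x u = \sum_j u 0 j *: 'd Theta x (e j)); last first.
  by rewrite {1}(row_sum_delta u) linear_sum; under eq_bigr do rewrite linearZ.
rewrite mulmx_sumr; under [X in _ = _ - dsq _ _ X]eq_bigr do rewrite -scalemxAr.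
rewrite dsq_suml// -big_split/= -sumrB; apply: eq_bigr => j _.
by rewrite mxE BE (hessC _ _ (y *m _)); field.
Unshelve. all: by end_near. Qed.

(** The Lie bracket, read in the frame, of the two fields with constant frame components [h] and
    [u]. *)
Definition frame_bracket h u : 'rV[R]_n :=
  (u *m 'd E x (h *m E x) - h *m 'd E x (u *m E x)) *m Theta x.

(* [h *m 'd E x (h *m E x)] is the acceleration of the integral curves of the
   field with constant components [h]. *)
Definition geodesic_defect h : 'rV[R]_n :=
  2 *: spray (h *m E x) + h *m 'd E x (h *m E x).

(** Differentiating [E *m Theta = 1] trades derivatives of the coframe for derivatives of the frame.
    The Hessian term on the right of [spray_frame] then cancels against the acceleration, and the
    two [dsq] terms combine into the bracket. *)
Lemma geodesic_defect_bracket h u : h != 0 ->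
  hess c h u (geodesic_defect h *m Theta x) = - dsq c h (frame_bracket h u).
Proof.
move=> h0; set y := h *m E x; set z := u *m E x.
have yT : y *m Theta x = h by rewrite -mulmxA ETx mulmx1.
have zT : z *m Theta x = u by rewrite -mulmxA ETx mulmx1.
have y0 : y != 0.
  by apply: contra_neq h0 => y0; rewrite -yT y0 mul0mx.
have dET v : E x *m 'd Theta x v = - 'd E x v *m Theta x.
  have dE : is_derive x v E ('d E x v).
    by split; [exact: diff_derivable | exact: deriveE].
  have dT : is_derive x v Theta ('d Theta x v).
    by split; [exact: diff_derivable | exact: deriveE].
  have [_] := is_derive_mulmx dE dT.
  rewrite (@near_eq_derive _ _ _ _ (cst 1%:M)) ?derive_cst => // /esym/eqP.
  by rewrite addrC addr_eq0 mulNmx => /eqP.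
have := spray_frame z y0; rewrite yT zT -!mulmxA !dET.
rewrite /geodesic_defect -/y mulmxDl hessDr -scalemxAl hessZr => ->.
rewrite /frame_bracket -/y -/z !mulNmx !mulmxN !mulmxBl dsqDr !dsqNr.
rewrite -!mulmxA -[- (h *m _)]scaleN1r hessZr; ring.
Qed.

Lemma frame_bracketNl h u : frame_bracket (- h) u = - frame_bracket h u.
Proof.
rewrite /frame_bracket -[RHS]mulNmx opprB; congr (_ *m _).
by rewrite !mulNmx linearN mulmxN opprK addrC.
Qed.

Lemma frame_bracket_self h : frame_bracket h h = 0.
Proof. by rewrite /frame_bracket subrr mul0mx. Qed.

Lemma frame_bracket0l u : frame_bracket 0 u = 0.
Proof. by rewrite /frame_bracket !mul0mx linear0 mulmx0 subr0 mul0mx. Qed.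

(* The Riemannian part of the identity is even in [h] and the part coming from
   [c] is odd, while the spray is even up to a multiple of [h]. *)
Lemma douglas_frame_bracket (Gamma : 'I_n -> 'I_n -> 'I_n -> R)
    (P : 'rV[R]_n -> R) :
  (forall y i, y != 0 -> spray_coefficient S F phi i x y =
     2^-1 * (\sum_j \sum_r Gamma i j r * y 0 j * y 0 r) + P y * y 0 i) ->
  forall h u, dot c (frame_bracket h u) = 0.
Proof.
move=> douglas h u.
have [->|h0] := eqVneq h 0; first by rewrite frame_bracket0l dot0r.
(* [Q] collects the terms known to be even: the quadratic part of twice the spray and the
   acceleration. *)
pose Q h : 'rV[R]_n := (\row_i (\sum_j \sum_r Gamma i j r
  * (h *m E x) 0 j * (h *m E x) 0 r) + h *m 'd E x (h *m E x)) *m Theta x.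
have QN v : Q (- v) = Q v.
  rewrite /Q !mulNmx linearN mulmxN opprK; congr ((_ + _) *m _).
  apply/rowP => i; rewrite !mxE; apply: eq_bigr => j _; apply: eq_bigr => r _.
  by rewrite !(mxE, mulrN, mulNr) opprK.
have E0 v : v != 0 -> v *m E x != 0.
  by apply: contra_neq => v0; rewrite -[v]mulmx1 -ETx mulmxA v0 mul0mx.
have defectE v : v != 0 -> geodesic_defect v *m Theta x =
    Q v + (2 * P (v *m E x)) *: v.
  move=> v0; rewrite /geodesic_defect /Q.
  rewrite (_ : 2 *: spray _ = \row_i (\sum_j \sum_r Gamma i j r
      * (v *m E x) 0 j * (v *m E x) 0 r) + (2 * P (v *m E x)) *: (v *m E x)).
    by rewrite [in LHS]addrAC [LHS]mulmxDl -scalemxAl -mulmxA ETx mulmx1.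
  by apply/rowP => i; rewrite !mxE douglas ?E0// mxE; field.
have key v : v != 0 -> angular v u (Q v) =
    - ((enorm v)^-1 * dot v (frame_bracket v u) + dot c (frame_bracket v u)).
  move=> v0; have f0 := rnorm_gt0 c_lt1 v0.
  (* Taking [u = v] makes the bracket vanish, and by homogeneity [hess] paired with [v] reduces to a
     positive multiple of [covec]. Only the angular part of the Hessian survives, and it does not
     see the multiple of [v] coming from [P]. *)
  have covQ : dot (covec c v) (geodesic_defect v *m Theta x) = 0.
    have := geodesic_defect_bracket v v0.
    rewrite frame_bracket_self /dsq dot0r mulr0 oppr0 /hess angularC.
    rewrite angular_self// mulr0 addr0 covec_self// mulrA => /eqP.
    by rewrite !mulf_eq0 pnatr_eq0 (gt_eqF f0)/= => /eqP.
  have := geodesic_defect_bracket u v0.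
  rewrite /hess covQ mulr0 add0r defectE// angularDr angularZr angular_self//.
  rewrite mulr0 addr0 /dsq -[2 * _ * _]mulrA -!mulrN dotDl dotZl.
  have two0 : 2 != 0 :> R by rewrite pnatr_eq0.
  by move/(mulfI two0)/(mulfI (lt0r_neq0 f0)).
have hN0 : - h != 0 by rewrite oppr_eq0.
have := key _ hN0; rewrite angularN QN key// enormN frame_bracketNl.
by rewrite !(dotNl, dotNr) opprK; lra.
Qed.

(** Once [c] is orthogonal to the brackets, [dsq] on them is a positive multiple of the inner
    product with [h]; definiteness of [hess] gives the converse direction. *)
Lemma geodesic_defect_eq0 h : h != 0 ->
  (forall u, dot c (frame_bracket h u) = 0) ->
  geodesic_defect h = 0 <-> forall u, dot h (frame_bracket h u) = 0.
Proof.
move=> h0 cB; have f0 := rnorm_gt0 c_lt1 h0.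
have dsqE u : dsq c h (frame_bracket h u) =
    2 * rnorm c h * (enorm h)^-1 * dot h (frame_bracket h u).
  by rewrite /dsq dotDl dotZl cB addr0 mulrA.
split=> [defect0 u|hB].
  have := geodesic_defect_bracket u h0.
  rewrite defect0 mul0mx -(scale0r 0) hessZr mul0r => /esym/eqP.
  rewrite oppr_eq0 dsqE !mulf_eq0 pnatr_eq0 (gt_eqF f0) invr_eq0.
  by rewrite (gt_eqF (enorm_gt0 h0))/= => /eqP.
suff defT0 : geodesic_defect h *m Theta x = 0.
  by rewrite -[LHS]mulmx1 -TEx mulmxA defT0 mul0mx.
apply: (hess_eq0 c_lt1 h0).
by rewrite geodesic_defect_bracket// dsqE hB mulr0 oppr0.
Qed.

End SprayInFrame.

(** * Change of coordinates *)

Section ChangeOfCoordinates.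
Context {R : realType} {n : nat}.
Variables (tau : 'rV[R]_n -> 'rV[R]_n) (x : 'rV[R]_n).
Hypothesis tau_diff : \forall z \near x, differentiable tau z.
Hypothesis Dtau_diff : forall v, differentiable ('D_v tau) x.

Lemma is_derive_diff_apply (f : 'rV[R]_n -> 'rV[R]_n) u :
  differentiable f x ->
  is_derive x u (fun z => 'd tau z (f z))
    ('d tau x ('d f x u) + 'D_u ('D_(f x) tau) x).
Proof.
(* The differentials are written as matrices so that the product rule for matrices applies. *)
move=> df; pose J z := lin1_mx ('d tau z).
have JE v z : 'd tau z v = v *m J z by rewrite mul_rV_lin1.
have dJ : derivable J x u.
  apply/derivable_mxP => i j.
  apply: (@near_eq_derivable _ _ _ (fun z => 'D_(delta_mx 0 i) tau z 0 j)).
    by apply: filterS tau_diff => z dz; rewrite mxE deriveE.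
  apply: (derivable_mxP _ _ _).1; exact: diff_derivable.
have DJ := derivableP dJ.
rewrite (_ : (fun z => 'd tau z (f z)) = fun z => f z *m J z); last first.
  by apply/funext => z; rewrite JE.
apply: is_derive_eq; first exact: (is_derive_mulmx (is_derive_diff u df) DJ).
rewrite -JE; congr (_ + _).
have [_] := is_derive_mulmx (is_derive_cst (f x) x u) DJ.
rewrite mul0mx add0r => <-; apply: near_eq_derive.
by apply: filterS tau_diff => z dz; rewrite -JE deriveE.
Qed.

(** Differentiating each related field along the other produces a second derivative of [tau] in the
    directions of the two fields; by symmetry these terms cancel in the difference. *)
Lemma bracket_change (f1 f2 g1 g2 : 'rV[R]_n -> 'rV[R]_n) :
  differentiable f1 x -> differentiable f2 x ->
  differentiable g1 (tau x) -> differentiable g2 (tau x) ->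
  (\forall z \near x, g1 (tau z) = 'd tau z (f1 z)) ->
  (\forall z \near x, g2 (tau z) = 'd tau z (f2 z)) ->
  'd g2 (tau x) (g1 (tau x)) - 'd g1 (tau x) (g2 (tau x))
  = 'd tau x ('d f2 x (f1 x) - 'd f1 x (f2 x)).
Proof.
move=> df1 df2 dg1 dg2 g1E g2E.
have dt : differentiable tau x := nbhs_singleton tau_diff.
have half f g u : differentiable f x -> differentiable g (tau x) ->
    (\forall z \near x, g (tau z) = 'd tau z (f z)) ->
    'd g (tau x) ('d tau x u) =
    'd tau x ('d f x u) + 'D_u ('D_(f x) tau) x.
  move=> df dg gE; have [_ <-] := is_derive_diff_apply u df.
  rewrite -(near_eq_derive _ gE); have dgt := differentiable_comp dt dg.
  transitivity ('d (g \o tau) x u); last exact: esym (deriveE u dgt).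
  exact: esym (congr1 (fun D => D u) (diff_comp dt dg)).
have e2 := etrans (congr1 ('d g2 (tau x)) (nbhs_singleton g1E))
  (half f2 g2 (f1 x) df2 dg2 g2E).
have e1 := etrans (congr1 ('d g1 (tau x)) (nbhs_singleton g2E))
  (half f1 g1 (f2 x) df1 dg1 g1E).
have sym := derive_comm_rV tau_diff (Dtau_diff (f2 x)) (Dtau_diff (f1 x)).
have cancel (L : {linear 'rV[R]_n -> 'rV[R]_n}) a b s s' :
    s = s' -> L a + s - (L b + s') = L (a - b).
  by move=> ->; rewrite linearB opprD addrACA subrr addr0.
exact: etrans (congr2 (fun a b => a - b) e2 e1) (cancel _ _ _ _ _ sym).
Qed.

End ChangeOfCoordinates.

(** * Tangent vectors and Lie brackets in different charts *)

Section Charts.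
Context {R : realType} {n : nat} {M : topologicalType}.
Variable S : smooth_structure R n M.
Implicit Types (phi psi chi : chart R n M) (p : M) (X Y : M -> 'rV[R]_n).
Implicit Types (x y v : 'rV[R]_n).

Lemma from_coordK phi p : atlas S phi -> dom phi p ->
  from_coord phi (phi p) = p.
Proof. by move=> /atlas_chart[_ _ chartK _] /chartK[]. Qed.

Lemma cod_to_coord phi p : atlas S phi -> dom phi p -> cod phi (phi p).
Proof. by move=> /atlas_chart[_ _ chartK _] /chartK[]. Qed.

Lemma to_coordK phi x : atlas S phi -> cod phi x -> phi (from_coord phi x) = x.
Proof. by move=> /atlas_chart[_ _ _ chartK] /chartK[]. Qed.

Lemma dom_from_coord phi x :
  atlas S phi -> cod phi x -> dom phi (from_coord phi x).
Proof. by move=> /atlas_chart[_ _ _ chartK] /chartK[]. Qed.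

Lemma near_cod phi x : atlas S phi -> cod phi x -> \forall z \near x, cod phi z.
Proof. by move=> /atlas_chart[_ ? _ _] ?; exact: open_nbhs_nbhs. Qed.

Lemma near_dom phi p : atlas S phi -> dom phi p -> \forall q \near p, dom phi q.
Proof. by move=> /atlas_chart[? _ _ _] ?; exact: open_nbhs_nbhs. Qed.

Lemma from_coord_continuous phi x : atlas S phi -> cod phi x ->
  {for x, continuous (from_coord phi)}.
Proof. by move=> /atlas_chart[_ _ _ chartK] /chartK[]. Qed.

Lemma near_overlap phi psi x : atlas S phi -> atlas S psi -> cod phi x ->
  dom psi (from_coord phi x) ->
  \forall z \near x, cod phi z /\ dom psi (from_coord phi z).
Proof.
move=> Sphi Spsi phix psix; near=> z; split; near: z; first exact: near_cod.
exact: (from_coord_continuous Sphi phix (near_dom Spsi psix)).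
Unshelve. all: by end_near. Qed.

Lemma transition_smooth phi psi : atlas S phi -> atlas S psi ->
  smooth_transition phi psi.
Proof. by move=> Sphi Spsi; have [] := atlas_compatible Sphi Spsi. Qed.

Lemma transition_differentiable phi psi x : atlas S phi -> atlas S psi ->
  cod phi x -> dom psi (from_coord phi x) ->
  differentiable (psi \o from_coord phi) x.
Proof.
move=> Sphi Spsi phix psix.
by have /(_ 1%N)[+ _] := transition_smooth Sphi Spsi; apply; split.
Qed.

Lemma transition_derive_differentiable phi psi x v :
  atlas S phi -> atlas S psi -> cod phi x -> dom psi (from_coord phi x) ->
  differentiable ('D_v (psi \o from_coord phi)) x.
Proof.
move=> Sphi Spsi phix psix.
have /(_ 2)[_ /(_ v)[+ _]] := transition_smooth Sphi Spsi; apply; by split.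
Qed.

Lemma transition_cocycle phi psi chi x v :
  atlas S phi -> atlas S psi -> atlas S chi -> cod phi x ->
  dom psi (from_coord phi x) -> dom chi (from_coord phi x) ->
  'd (chi \o from_coord psi) (psi (from_coord phi x))
    ('d (psi \o from_coord phi) x v)
  = 'd (chi \o from_coord phi) x v.
Proof.
move=> Sphi Spsi Schi phix psix chix.
have fromK : from_coord psi (psi (from_coord phi x)) = from_coord phi x.
  exact: from_coordK.
have dtau := transition_differentiable Sphi Spsi phix psix.
have dtau' : differentiable (chi \o from_coord psi) (psi (from_coord phi x)).
  by apply: transition_differentiable; rewrite ?fromK//; exact: cod_to_coord.
have factor : \forall z \near x,
    (chi \o from_coord psi \o (psi \o from_coord phi)) z =
    (chi \o from_coord phi) z.
  near=> z; have [_ psiz] : cod phi z /\ dom psi (from_coord phi z).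
    by near: z; exact: near_overlap.
  by rewrite /= from_coordK.
have D1 := near_eq_diff factor (differentiable_comp dtau dtau').
have D2 := diff_comp dtau dtau'.
exact: esym (congr1 (fun D => D v) (etrans D1 D2)).
Unshelve. all: by end_near. Qed.

Lemma diff_transition_self phi x v : atlas S phi -> cod phi x ->
  'd (phi \o from_coord phi) x v = v.
Proof.
move=> Sphi phix.
have idE : \forall z \near x, id z = (phi \o from_coord phi) z.
  by near=> z; rewrite /= to_coordK//; near: z; exact: near_cod.
have D1 := near_eq_diff idE (ex_diff (is_diff_def := is_diff_id x)).
have D2 := diff_val (is_diff_def := is_diff_id x).
by have := congr1 (@^~ v) (etrans D1 D2).
Unshelve. all: by end_near. Qed.

Lemma field_in_to_coord phi X p : atlas S phi -> dom phi p ->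
  field_in S phi X (phi p) = components S phi p (X p).
Proof. by move=> Sphi phip; rewrite /field_in from_coordK. Qed.

Lemma components_transition phi psi p v : atlas S phi -> atlas S psi ->
  dom phi p -> dom psi p ->
  components S psi p v
  = 'd (psi \o from_coord phi) (phi p) (components S phi p v).
Proof.
move=> Sphi Spsi phip psip; have Sp := atlas_chart_at S p.
have Dp := dom_chart_at S p.
have pK := from_coordK Sp Dp.
have cp := cod_to_coord Sp Dp.
have := @transition_cocycle _ _ _ _ v Sp Sphi Spsi cp.
by rewrite pK => /(_ phip psip) ->.
Qed.

Lemma components_chart_at p v : components S (chart_at S p) p v = v.
Proof.
apply: diff_transition_self; first exact: atlas_chart_at.
exact: cod_to_coord (atlas_chart_at S p) (dom_chart_at S p).
Qed.

Lemma field_in_transition phi psi X x : atlas S phi -> atlas S psi ->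
  cod phi x -> dom psi (from_coord phi x) ->
  field_in S psi X (psi (from_coord phi x))
  = 'd (psi \o from_coord phi) x (field_in S phi X x).
Proof.
move=> Sphi Spsi phix psix; rewrite (field_in_to_coord X Spsi psix).
have := components_transition (X (from_coord phi x)) Sphi Spsi
  (dom_from_coord Sphi phix) psix.
by rewrite (to_coordK Sphi phix).
Qed.

Lemma of_componentsK phi x v : atlas S phi -> cod phi x ->
  of_components S phi x (components S phi (from_coord phi x) v) = v.
Proof.
move=> Sphi phix; have phip := dom_from_coord Sphi phix.
have Sp := atlas_chart_at S (from_coord phi x).
have Dp := dom_chart_at S (from_coord phi x).
rewrite -{2}[v](components_chart_at (from_coord phi x)).
have := components_transition v Sphi Sp phip Dp.
by rewrite /of_components (to_coordK Sphi phix).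
Qed.

Lemma of_components_field_in phi X x : atlas S phi -> cod phi x ->
  of_components S phi x (field_in S phi X x) = X (from_coord phi x).
Proof. exact: of_componentsK. Qed.

Lemma smooth_field_differentiable phi X x : smooth_field S X ->
  atlas S phi -> cod phi x -> differentiable (field_in S phi X) x.
Proof. by move=> sX Sphi phix; have /(_ 1%N)[+ _] := sX phi Sphi; apply. Qed.

(** [lie_bracket] uses at each point the preferred chart of that point; naturality under the
    transition to [phi] gives the same formula in one fixed chart. *)
Lemma lie_bracket_in phi X Y x : smooth_field S X -> smooth_field S Y ->
  atlas S phi -> cod phi x ->
  field_in S phi (lie_bracket S X Y) x
  = 'd (field_in S phi Y) x (field_in S phi X x)
    - 'd (field_in S phi X) x (field_in S phi Y x).
Proof.
move=> sX sY Sphi phix; set p := from_coord phi x; set psi := chart_at S p.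
have phip : dom phi p := dom_from_coord Sphi phix.
have Spsi : atlas S psi := atlas_chart_at S p.
have psip : dom psi p := dom_chart_at S p.
have psiK : from_coord psi (psi p) = p := from_coordK Spsi psip.
have codp : cod psi (psi p) := cod_to_coord Spsi psip.
have xE : (phi \o from_coord psi) (psi p) = x by rewrite /= psiK to_coordK.
have near_tau : \forall z \near psi p, cod psi z /\ dom phi (from_coord psi z).
  by apply: near_overlap => //; rewrite psiK.
have tr Z : \forall z \near psi p,
    field_in S phi Z ((phi \o from_coord psi) z) =
    'd (phi \o from_coord psi) z (field_in S psi Z z).
  by apply: filterS near_tau => z [? ?]; rewrite /= field_in_transition.
have dtau : \forall z \near psi p, differentiable (phi \o from_coord psi) z.
  by apply: filterS near_tau => z [? ?]; exact: transition_differentiable.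
have Dtau v : differentiable ('D_v (phi \o from_coord psi)) (psi p).
  by apply: transition_derive_differentiable => //; rewrite psiK.
have diff_psi Z : smooth_field S Z -> differentiable (field_in S psi Z) (psi p).
  by move=> sZ; exact: smooth_field_differentiable.
have diff_phi Z : smooth_field S Z ->
    differentiable (field_in S phi Z) ((phi \o from_coord psi) (psi p)).
  by move=> sZ; rewrite xE; exact: smooth_field_differentiable.
have := bracket_change dtau Dtau (diff_psi X sX) (diff_psi Y sY)
  (diff_phi X sX) (diff_phi Y sY) (tr X) (tr Y).
rewrite xE => ->.
have := components_transition (lie_bracket S X Y p) Spsi Sphi psip phip.
rewrite components_chart_at => brE; apply: etrans brE _.
have fE Z : field_in S psi Z (psi p) = Z p.
  by rewrite field_in_to_coord// components_chart_at.
by rewrite !fE.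
Qed.

End Charts.

(** * Left invariant fields and one-parameter subgroups *)

Section Smoothness.
Context {R : realType} {V W : normedModType R}.
Implicit Types (D : set V) (f g : V -> W).

Lemma near_eq_on D f g x : open D -> (forall z, D z -> f z = g z) -> D x ->
  \forall z \near x, f z = g z.
Proof.
move=> Dop fg Dx; apply: filterS (open_nbhs_nbhs (conj Dop Dx)); exact: fg.
Qed.

Lemma eq_Ck k D f g : open D -> (forall z, D z -> f z = g z) ->
  Ck k D f -> Ck k D g.
Proof.
move=> Dop; elim: k f g => [|k IH] f g fg /=.
  move=> fc x Dx; have fgx := near_eq_on Dop fg Dx.
  rewrite /prop_for /continuous_at -(fg _ Dx).
  exact: cvg_trans (near_eq_cvg fgx) (fc x Dx).
move=> [df Ckf]; split=> [x Dx|v].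
  exact: near_eq_differentiable (near_eq_on Dop fg Dx) (df x Dx).
apply: IH (Ckf v) => z Dz; exact: near_eq_derive (near_eq_on Dop fg Dz).
Qed.

Lemma Ck_lincomb k D f g (s : R) : open D -> Ck k D f -> Ck k D g ->
  Ck k D (s *: f + g).
Proof.
move=> Dop; elim: k f g => [|k IH] f g /=.
  move=> fc gc x Dx; apply: continuousD (gc x Dx).
  exact: continuousZl_tmp (fc x Dx).
move=> [df Ckf] [dg Ckg]; split=> [x Dx|v].
  exact: differentiableD (differentiableZ s (df x Dx)) (dg x Dx).
apply: (@eq_Ck _ _ (s *: 'D_v f + 'D_v g) _ Dop) (IH _ _ (Ckf v) (Ckg v)).
move=> z Dz; have fz : derivable f z v := diff_derivable (df z Dz).
have gz : derivable g z v := diff_derivable (dg z Dz).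
have [_ /esym] := is_deriveD (is_deriveZ s (derivableP fz)) (derivableP gz).
exact.
Qed.

End Smoothness.

Section Fields.
Context {R : realType} {n : nat} {M : topologicalType}.
Variable S : smooth_structure R n M.
Implicit Types (phi : chart R n M) (X Y : M -> 'rV[R]_n) (p : M).
Implicit Types (x y : 'rV[R]_n).

HB.instance Definition _ phi p :=
  GRing.Linear.copy (components S phi p)
    ('d (phi \o from_coord (chart_at S p)) (chart_at S p p)).

HB.instance Definition _ phi x :=
  GRing.Linear.copy (of_components S phi x)
    ('d (chart_at S (from_coord phi x) \o from_coord phi) x).

HB.instance Definition _ (f : M -> M) p :=
  GRing.Linear.copy (tangent_map S f p)
    ('d (chart_at S (f p) \o f \o from_coord (chart_at S p))
        (chart_at S p p)).

Lemma field_in_lincomb phi (s : R) X Y :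
  field_in S phi (s *: X + Y) = s *: field_in S phi X + field_in S phi Y.
Proof.
apply/funext => z.
exact: (linearP (components S phi (from_coord phi z)) s
  (X (from_coord phi z)) (Y (from_coord phi z))).
Qed.

Lemma field_in_sum phi m (h : 'I_m -> R) (E : 'I_m -> M -> 'rV[R]_n) z :
  field_in S phi (\sum_i h i *: E i) z = \sum_i h i *: field_in S phi (E i) z.
Proof.
rewrite /field_in fct_sumE.
rewrite [LHS](linear_sum (components S phi (from_coord phi z))).
apply: eq_bigr => i _; exact: (linearZZ (components S phi (from_coord phi z))).
Qed.

Lemma smooth_field_lincomb (s : R) X Y :
  smooth_field S X -> smooth_field S Y -> smooth_field S (s *: X + Y).
Proof.
move=> sX sY phi Sphi k; rewrite field_in_lincomb; apply: Ck_lincomb.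
- by have [] := atlas_chart Sphi.
- exact: sX.
- exact: sY.
Qed.

Lemma smooth_field0 : smooth_field S 0.
Proof.
move=> phi Sphi k; rewrite (_ : field_in S phi 0 = 0); last first.
  by apply/funext => z; exact: (linear0 (components S phi (from_coord phi z))).
have : forall D : set 'rV[R]_n, Ck k D (0 : 'rV[R]_n -> 'rV[R]_n).
  elim: k => [|k IH] D /=; first by move=> x _; exact: cst_continuous.
  split=> [x _|v]; first exact: differentiable_cst.
  rewrite (_ : 'D_v (0 : 'rV[R]_n -> 'rV[R]_n) = 0) //.
  by apply/funext => z; rewrite derive_cst.
exact.
Qed.

End Fields.

Section LeftInvariantFields.
Context {R : realType} {n : nat} {G : groupTopologicalType}.
Variable S : smooth_structure R n G.
Implicit Types (phi psi : chart R n G) (X Y : G -> 'rV[R]_n) (g p : G).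

Lemma left_invariant_lincomb (s : R) X Y : left_invariant_field S X ->
  left_invariant_field S Y -> left_invariant_field S (s *: X + Y).
Proof.
move=> [sX tX] [sY tY]; split=> [|g p]; first exact: smooth_field_lincomb.
exact: etrans (linearP (tangent_map S (fun h => (g * h)%g) p) s (X p) (Y p))
  (congr2 (fun u v => s *: u + v) (tX g p) (tY g p)).
Qed.

Lemma left_invariant_sum m (h : 'I_m -> R) (E : 'I_m -> G -> 'rV[R]_n) :
  (forall i, left_invariant_field S (E i)) ->
  left_invariant_field S (\sum_i h i *: E i).
Proof.
move=> LE; elim/big_rec: _ => [|i X _ LX]; last exact: left_invariant_lincomb.
split=> [|g p]; first exact: smooth_field0.
exact: (linear0 (tangent_map S (fun h => (g * h)%g) p)).
Qed.

Hypothesis G_lie : lie_group S.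

(** Smoothness is given for multiplication in both variables; left translation is its restriction to
    the slice where the first factor has the coordinates of [g]. *)
Lemma left_translation_differentiable phi psi g x :
  atlas S phi -> atlas S psi ->
  cod phi x -> dom psi (g * from_coord phi x)%g ->
  differentiable (fun z => psi (g * from_coord phi z)%g) x.
Proof.
move=> Sphi Spsi phix psigx; have [_ _ mul_smooth _] := G_lie.
have Sg := atlas_chart_at S g; have Dg := dom_chart_at S g.
have /(_ 1%N)[+ _] := mul_smooth _ _ _ Sg Sphi Spsi.
move=> /(_ (chart_at S g g, x))/(_ _)/wrap[].
  split=> /=; last by rewrite (from_coordK Sg Dg).
  by split; [exact: (cod_to_coord Sg Dg)|exact: phix].
move=> dmul.
have dpair : differentiable (fun z => (chart_at S g g, z)) x.
  by apply: differentiable_pair; [exact: differentiable_cst | exact: ex_diff].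
have := differentiable_comp dpair dmul.
rewrite (_ : (_ \o _) \o _ = fun z => psi (g * from_coord phi z)%g)//.
by apply/funext => z /=; rewrite (from_coordK Sg Dg).
Qed.

Variables (c : R -> G) (Y : G -> 'rV[R]_n).
Hypothesis Y_left_invariant : left_invariant_field S Y.
Hypothesis c_subgroup : one_parameter_subgroup S c Y.

Let c_continuous : continuous c. Proof. by have [[]] := c_subgroup. Qed.

Lemma subgroup_differentiable phi t : atlas S phi -> dom phi (c t) ->
  differentiable (phi \o c) t.
Proof.
by move=> Sphi phit; have [[_ /(_ phi Sphi 1%N)[+ _]] _ _] := c_subgroup; apply.
Qed.

Lemma near_subgroup_dom phi t : atlas S phi -> dom phi (c t) ->
  \forall s \near t, dom phi (c s).
Proof. by move=> Sphi phit; exact: (c_continuous (near_dom Sphi phit)). Qed.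

(** Near [t] the curve is the left translate by [c t] of the curve near 0, and left invariance
    carries the initial velocity along. *)
Lemma subgroup_velocity t : velocity S c t = Y (c t).
Proof.
have [_ cD c'0] := c_subgroup.
have S0 := atlas_chart_at S (c 0); have D0 := dom_chart_at S (c 0).
have St := atlas_chart_at S (c t); have Dt := dom_chart_at S (c t).
have ct0 : (c t * c 0)%g = c t by rewrite -cD addr0.
pose L := fun z => chart_at S (c t) (c t * from_coord (chart_at S (c 0)) z)%g.
have dL : differentiable L (chart_at S (c 0) (c 0)).
  apply: (left_translation_differentiable S0 St (cod_to_coord S0 D0)).
  by rewrite (from_coordK S0 D0) ct0.
have d0 := subgroup_differentiable S0 D0.
have near0 : \forall s \near (0 : R),
    (L \o (chart_at S (c 0) \o c)) s = (chart_at S (c t) \o c) (s + t).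
  near=> s; rewrite /L /= (from_coordK S0)//; first by rewrite addrC cD.
  by near: s; exact: near_subgroup_dom.
transitivity (derive1 (fun s => (chart_at S (c t) \o c) (s + t)) 0).
  rewrite /velocity /derive1.
  set g1 := (X in lim (X @ _) = _); set g2 := (X in _ = lim (X @ _)).
  by suff -> : g1 = g2 by []; apply/funext => h; rewrite /g1 /g2 addr0 add0r.
rewrite derive1E -(near_eq_derive _ near0).
rewrite (deriveE _ (differentiable_comp d0 dL)).
have D2 := congr1 (@^~ 1) (diff_comp d0 dL).
apply: etrans D2 _ => /=.
rewrite -(derive1E' d0) (_ : derive1 _ _ = Y (c 0)); last exact: c'0.
by have [_ /(_ (c t) (c 0))] := Y_left_invariant; rewrite /tangent_map ct0.
Unshelve. all: by end_near. Qed.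

Lemma subgroup_derive1 phi t : atlas S phi -> dom phi (c t) ->
  derive1 (phi \o c) t = field_in S phi Y (phi (c t)).
Proof.
move=> Sphi phit; have St := atlas_chart_at S (c t).
have Dt := dom_chart_at S (c t); have dt := subgroup_differentiable St Dt.
have dphi : differentiable (phi \o from_coord (chart_at S (c t)))
    (chart_at S (c t) (c t)).
  apply: (transition_differentiable St Sphi (cod_to_coord St Dt)).
  by rewrite (from_coordK St Dt).
have near_t : \forall s \near t, ((phi \o from_coord (chart_at S (c t))) \o
    (chart_at S (c t) \o c)) s = (phi \o c) s.
  near=> s; rewrite /= (from_coordK St)//; near: s; exact: near_subgroup_dom.
rewrite derive1E -(near_eq_derive _ near_t).
rewrite (deriveE _ (differentiable_comp dt dphi)).
apply: etrans (congr1 (@^~ 1) (diff_comp dt dphi)) _ => /=.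
rewrite -(derive1E' dt) (_ : derive1 _ _ = Y (c t)).
  by rewrite field_in_to_coord.
exact: subgroup_velocity.
Unshelve. all: by end_near. Qed.

Lemma subgroup_derive2 phi t : atlas S phi -> dom phi (c t) ->
  derive1n 2 (phi \o c) t =
  'd (field_in S phi Y) (phi (c t)) (field_in S phi Y (phi (c t))).
Proof.
move=> Sphi phit; have dc := subgroup_differentiable Sphi phit.
have dY : differentiable (field_in S phi Y) ((phi \o c) t).
  have [sY _] := Y_left_invariant.
  exact: (smooth_field_differentiable sY Sphi (cod_to_coord Sphi phit)).
have near_t : \forall s \near t,
    (field_in S phi Y \o (phi \o c)) s = derive1 (phi \o c) s.
  near=> s; rewrite subgroup_derive1//; near: s; exact: near_subgroup_dom.
rewrite derive1nS derive1n1 derive1E -(near_eq_derive _ near_t).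
rewrite (deriveE _ (differentiable_comp dc dY)).
apply: etrans (congr1 (@^~ 1) (diff_comp dc dY)) _ => /=.
by rewrite -(derive1E' dc) subgroup_derive1.
Unshelve. all: by end_near. Qed.

End LeftInvariantFields.

(** * Orthonormal frames *)

Lemma differentiable_mx {R : realType} {V : normedModType R} {m n : nat}
    (A : V -> 'M[R]_(m, n)) x :
  (forall i j, differentiable (fun z => A z i j) x) -> differentiable A x.
Proof.
move=> dA.
rewrite (_ : A = \sum_i \sum_j (fun z => A z i j *: delta_mx i j)); last first.
  apply/funext => z; rewrite fct_sumE [LHS]matrix_sum_delta.
  by apply: eq_bigr => i _; rewrite fct_sumE.
apply: differentiable_sum => i; apply: differentiable_sum => j.
exact: differentiableZl (dA i j).
Qed.

Section OrthonormalFrame.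
Context {R : realType} {n : nat} {M : topologicalType}.
Variable S : smooth_structure R n M.
Variables (a : M -> 'rV[R]_n -> 'rV[R]_n -> R) (E : 'I_n -> M -> 'rV[R]_n).
Hypothesis a_metric : riemannian_metric S a.
Hypothesis E_smooth : forall i, smooth_field S (E i).
Hypothesis E_orthonormal : forall p i j, a p (E i p) (E j p) = (i == j)%:R.
Implicit Types (phi : chart R n M) (p : M) (x y h u v w : 'rV[R]_n).

Local Notation e i := (delta_mx (0 : 'I_1) (i : 'I_n) : 'rV[R]_n).

Lemma metricC p u v : a p u v = a p v u.
Proof. by have [+ _ _ _] := a_metric; exact. Qed.

Lemma metric0l p w : a p 0 w = 0.
Proof.
have [_ /(_ p 1 0 0 w) + _ _] := a_metric.
rewrite scaler0 addr0 mul1r => /eqP.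
by rewrite -subr_eq0 opprD addrA subrr add0r oppr_eq0 => /eqP.
Qed.

Lemma metric_suml p m (s : 'I_m -> R) (v : 'I_m -> 'rV[R]_n) w :
  a p (\sum_i s i *: v i) w = \sum_i s i * a p (v i) w.
Proof.
have [_ lin _ _] := a_metric.
by elim/big_rec2: _ => [|i r t _ <-]; [exact: metric0l | rewrite lin].
Qed.

Lemma metric_sumr p m (s : 'I_m -> R) (v : 'I_m -> 'rV[R]_n) w :
  a p w (\sum_i s i *: v i) = \sum_i s i * a p w (v i).
Proof. by rewrite metricC metric_suml; under eq_bigr do rewrite metricC. Qed.

Definition lincomb h : M -> 'rV[R]_n := \sum_i h 0 i *: E i.

Lemma lincombE h p : lincomb h p = \sum_i h 0 i *: E i p.
Proof. by rewrite /lincomb fct_sumE. Qed.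

Lemma metric_lincomb_frame h p j : a p (lincomb h p) (E j p) = h 0 j.
Proof.
rewrite lincombE metric_suml (bigD1 j)//= big1 => [|i ij].
  by rewrite E_orthonormal eqxx mulr1 addr0.
by rewrite E_orthonormal (negbTE ij) mulr0.
Qed.

Lemma metric_lincomb h u p : a p (lincomb h p) (lincomb u p) = dot h u.
Proof.
rewrite [in X in a p _ X]lincombE metric_sumr dotE; apply: eq_bigr => i _.
by rewrite metric_lincomb_frame mulrC.
Qed.

Lemma lincomb_inj h u p : lincomb h p = lincomb u p -> h = u.
Proof.
by move=> hu; apply/rowP => j; rewrite -(metric_lincomb_frame h p) hu
  metric_lincomb_frame.
Qed.

Lemma lincomb_smooth h : smooth_field S (lincomb h).
Proof.
rewrite /lincomb; elim/big_rec: _ => [|i X _ sX]; first exact: smooth_field0.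
exact: smooth_field_lincomb.
Qed.

Definition frame_mx phi x : 'M[R]_n :=
  \matrix_(i, j) field_in S phi (E i) x 0 j.

(** The inverse of the frame matrix: in an orthonormal frame, components are inner products. Its
    differentiability thus comes from the metric instead of a matrix inversion. *)
Definition coframe_mx phi x : 'M[R]_n :=
  \matrix_(j, i) a (from_coord phi x) (of_components S phi x (e j))
                   (E i (from_coord phi x)).

Lemma field_in_lincombE phi h x :
  field_in S phi (lincomb h) x = h *m frame_mx phi x.
Proof.
rewrite /lincomb field_in_sum; apply/rowP => j; rewrite mxE summxE.
by apply: eq_bigr => i _; rewrite !mxE.
Qed.

Lemma of_components_sum phi x w : of_components S phi x w
  = \sum_j w 0 j *: of_components S phi x (e j).
Proof.
rewrite [in LHS](row_sum_delta w) (linear_sum (of_components S phi x)).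
by apply: eq_bigr => j _; rewrite (linearZZ (of_components S phi x)).
Qed.

Lemma mul_coframe_mx phi x w i :
  (w *m coframe_mx phi x) 0 i =
  a (from_coord phi x) (of_components S phi x w) (E i (from_coord phi x)).
Proof.
rewrite mxE [in RHS]of_components_sum metric_suml; apply: eq_bigr => j _.
by rewrite mxE.
Qed.

Lemma frame_coframe_mx phi x : atlas S phi -> cod phi x ->
  frame_mx phi x *m coframe_mx phi x = 1%:M.
Proof.
move=> Sphi phix; apply/row_matrixP => i; rewrite row_mul row1; apply/rowP => j.
rewrite mul_coframe_mx (_ : row i _ = field_in S phi (E i) x); last first.
  by apply/rowP => l; rewrite !mxE.
by rewrite of_components_field_in// E_orthonormal mxE eqxx/= eq_sym.
Qed.

Lemma of_components_lincomb phi x w : atlas S phi -> cod phi x ->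
  of_components S phi x w = lincomb (w *m coframe_mx phi x) (from_coord phi x).
Proof.
move=> Sphi phix.
have /mulmx1C coframe_frame := frame_coframe_mx Sphi phix.
rewrite -[lincomb _ _](of_components_field_in _ Sphi phix) field_in_lincombE.
by rewrite -mulmxA coframe_frame mulmx1.
Qed.

Lemma randers_frame c phi x w : atlas S phi -> cod phi x ->
  finsler_in S (randers a (lincomb c)) phi x w
  = rnorm c (w *m coframe_mx phi x).
Proof.
move=> Sphi phix; rewrite /finsler_in /randers of_components_lincomb//.
by rewrite !metric_lincomb.
Qed.

Lemma frame_mx_differentiable phi x : atlas S phi -> cod phi x ->
  differentiable (frame_mx phi) x.
Proof.
move=> Sphi phix; apply: differentiable_mx => i j.
have dE := smooth_field_differentiable (E_smooth i) Sphi phix.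
have := differentiable_comp dE (differentiable_coord _ 0 j).
rewrite (_ : _ \o _ = fun z => frame_mx phi z i j)//.
by apply/funext => z; rewrite mxE.
Qed.

Lemma coframe_mx_differentiable phi x : atlas S phi -> cod phi x ->
  differentiable (coframe_mx phi) x.
Proof.
move=> Sphi phix; apply: differentiable_mx => j i.
have [_ _ _ a_smooth] := a_metric.
have da l : differentiable (fun z => a (from_coord phi z)
    (of_components S phi z (e j)) (of_components S phi z (e l))) x.
  by have /(_ 1%N)[+ _] := a_smooth phi (e j) (e l) Sphi; apply.
have dE l : differentiable (fun z => field_in S phi (E i) z 0 l) x.
  have dEi := smooth_field_differentiable (E_smooth i) Sphi phix.
  exact: (differentiable_comp dEi (differentiable_coord _ 0 l)).
(* The metric is smooth on coordinate fields, so [E i] is expanded in these. *)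
have dsum : differentiable (\sum_l ((fun z => field_in S phi (E i) z 0 l) *
    (fun z => a (from_coord phi z) (of_components S phi z (e j))
       (of_components S phi z (e l))))) x.
  by apply: differentiable_sum => l; exact: differentiableM (dE l) (da l).
apply: near_eq_differentiable dsum; near=> z.
have phiz : cod phi z by near: z; exact: (near_cod Sphi phix).
rewrite fct_sumE mxE -(of_components_field_in (E i) Sphi phiz).
rewrite (of_components_sum phi z (field_in S phi (E i) z)) metric_sumr.
Unshelve. all: by end_near. Qed.

Lemma diff_field_in_lincomb phi h x v : atlas S phi -> cod phi x ->
  'd (field_in S phi (lincomb h)) x v = h *m 'd (frame_mx phi) x v.
Proof.
move=> Sphi phix; have dE := frame_mx_differentiable Sphi phix.
have dh := smooth_field_differentiable (lincomb_smooth h) Sphi phix.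
apply: etrans (esym (deriveE v dh)) _.
have fE : field_in S phi (lincomb h) = fun z => h *m frame_mx phi z.
  by apply/funext => z; rewrite field_in_lincombE.
have [_] := is_derive_mulmx (is_derive_cst h x v) (is_derive_diff v dE).
by rewrite mul0mx add0r fE.
Qed.

Lemma diff_field_in_sum phi h x v : atlas S phi -> cod phi x ->
  'd (field_in S phi (lincomb h)) x v
  = \sum_j h 0 j *: 'd (field_in S phi (E j)) x v.
Proof.
move=> Sphi phix.
have dh := smooth_field_differentiable (lincomb_smooth h) Sphi phix.
have fE : field_in S phi (lincomb h) = \sum_j (h 0 j \*: field_in S phi (E j)).
  by apply/funext => z; rewrite /lincomb field_in_sum fct_sumE.
apply: etrans (esym (deriveE v dh)) _; rewrite fE.
apply: derive_val; apply: is_derive_sum => j; apply: is_deriveZ.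
exact: is_derive_diff (smooth_field_differentiable (E_smooth j) Sphi phix).
Qed.

Lemma lie_bracket_lincomb h u : lie_bracket S (lincomb h) (lincomb u)
  = \sum_i \sum_j (h 0 i * u 0 j) *: lie_bracket S (E i) (E j).
Proof.
apply/funext => p; rewrite fct_sumE.
have Sp := atlas_chart_at S p; have Dp := dom_chart_at S p.
have codp := cod_to_coord Sp Dp.
have half v w : 'd (field_in S (chart_at S p) (lincomb w)) (chart_at S p p)
    (lincomb v p) = \sum_i \sum_j (v 0 i * w 0 j) *:
    'd (field_in S (chart_at S p) (E j)) (chart_at S p p) (E i p).
  apply: etrans (diff_field_in_sum w (lincomb v p) Sp codp) _.
  rewrite exchange_big/=; apply: eq_bigr => j _.
  rewrite lincombE (linear_sum ('d (field_in S (chart_at S p) (E j)) _)).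
  rewrite scaler_sumr; apply: eq_bigr => i _.
  by rewrite (linearZZ ('d (field_in S (chart_at S p) (E j)) _)) scalerA mulrC.
apply: etrans (congr2 (fun v w => v - w) (half h u) (half u h)) _.
rewrite [X in _ - X]exchange_big/= -sumrB; apply: eq_bigr => i _.
rewrite fct_sumE -sumrB; apply: eq_bigr => j _.
by rewrite [u 0 j * _]mulrC -scalerBr.
Qed.

(** Links the matrix formula in a chart to the Lie algebra: its value [b] depends neither on the
    chart nor on the point. *)
Lemma frame_bracketE phi h u b x : atlas S phi -> cod phi x ->
  lie_bracket S (lincomb h) (lincomb u) = lincomb b ->
  frame_bracket (frame_mx phi) (coframe_mx phi) x h u = b.
Proof.
move=> Sphi phix hub.
have LB := lie_bracket_in (lincomb_smooth h) (lincomb_smooth u) Sphi phix.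
have dE v w := diff_field_in_lincomb v (field_in S phi (lincomb w) x) Sphi phix.
have bE : b *m frame_mx phi x =
    u *m 'd (frame_mx phi) x (h *m frame_mx phi x) -
    h *m 'd (frame_mx phi) x (u *m frame_mx phi x).
  apply: etrans (esym (field_in_lincombE phi b x)) _; rewrite -hub.
  apply: etrans LB (etrans (congr2 (fun v w => v - w) (dE u h) (dE h u)) _).
  by rewrite (field_in_lincombE phi h x) (field_in_lincombE phi u x).
rewrite /frame_bracket -bE -mulmxA.
by rewrite (frame_coframe_mx Sphi phix) mulmx1.
Qed.

End OrthonormalFrame.

(** * Geodesic vectors *)

Lemma left_invariant_dot {R : realType} {n : nat} {G : groupTopologicalType}
    (S : smooth_structure R n G) (a : G -> 'rV[R]_n -> 'rV[R]_n -> R)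
    (X Y : G -> 'rV[R]_n) (p : G) :
  left_invariant_metric S a -> left_invariant_field S X ->
  left_invariant_field S Y -> a p (X p) (Y p) = lie_dot a X Y.
Proof.
move=> [_ a_inv] [_ X_inv] [_ Y_inv].
have := a_inv p 1%g (X 1%g) (Y 1%g) => /=.
by rewrite (X_inv p 1%g) (Y_inv p 1%g) mulg1.
Qed.

Section GeodesicVectors.
Context {R : realType} {n : nat} {G : groupTopologicalType}.
Variable S : smooth_structure R n G.
Hypothesis G_lie : lie_group S.
Variables (a : G -> 'rV[R]_n -> 'rV[R]_n -> R) (E : 'I_n -> G -> 'rV[R]_n).
Hypothesis a_left_invariant : left_invariant_metric S a.
Hypothesis E_left_invariant : forall i, left_invariant_field S (E i).
Hypothesis E_orthonormal : forall i j, lie_dot a (E i) (E j) = (i == j)%:R.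
(** [B] is the bracket of the Lie algebra on frame components. *)
Variable B : 'rV[R]_n -> 'rV[R]_n -> 'rV[R]_n.
Hypothesis E_bracket : forall h u,
  lie_bracket S (lincomb E h) (lincomb E u) = lincomb E (B h u).
Variable c : 'rV[R]_n.
Hypothesis c_lt1 : dot c c < 1.
Hypothesis F_douglas : douglas_type S (randers a (lincomb E c)).

Let a_metric : riemannian_metric S a.
Proof. by have [] := a_left_invariant. Qed.

Let E_smooth i : smooth_field S (E i).
Proof. by have [] := E_left_invariant i. Qed.

Let E_on p i j : a p (E i p) (E j p) = (i == j)%:R.
Proof. by rewrite (left_invariant_dot p a_left_invariant). Qed.

Section InChart.
Variables (phi : chart R n G) (x : 'rV[R]_n).
Hypotheses (Sphi : atlas S phi) (phix : cod phi x).

Let F_frame : \forall z \near x, forall w,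
  finsler_in S (randers a (lincomb E c)) phi z w
  = rnorm c (w *m coframe_mx S a E phi z).
Proof.
by apply: filterS (near_cod Sphi phix) => z phiz w; exact: randers_frame.
Qed.

Let E_Theta : \forall z \near x,
  frame_mx S E phi z *m coframe_mx S a E phi z = 1%:M.
Proof.
by apply: filterS (near_cod Sphi phix) => z phiz; exact: frame_coframe_mx.
Qed.

Let dE := frame_mx_differentiable E_smooth Sphi phix.
Let dTheta := coframe_mx_differentiable a_metric E_smooth Sphi phix.

Let bracketE h u :
  frame_bracket (frame_mx S E phi) (coframe_mx S a E phi) x h u = B h u.
Proof. exact: frame_bracketE (E_bracket h u). Qed.

(** The Douglas condition forces the vector field of the Randers metric to be orthogonal to the
    derived algebra. *)
Lemma douglas_in_chart h u : dot c (B h u) = 0.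
Proof.
have [Gamma [P [_ douglas]]] := F_douglas Sphi.
have := @douglas_frame_bracket _ _ _ _ _ _ _ c_lt1 _ _ _
  F_frame E_Theta dE dTheta (fun i j r => Gamma i j r x)
  (P x) (fun y i => douglas x y i phix) h u.
by rewrite bracketE.
Qed.

Lemma geodesic_defect_in_chart h : h != 0 ->
  geodesic_defect S (randers a (lincomb E c)) phi (frame_mx S E phi) x h = 0
  <-> forall u, dot h (B h u) = 0.
Proof.
move=> h0.
have cB u : dot c
    (frame_bracket (frame_mx S E phi) (coframe_mx S a E phi) x h u) = 0.
  by rewrite bracketE douglas_in_chart.
have [defectB Bdefect] := @geodesic_defect_eq0 _ _ _ _ _ _ _ c_lt1 _ _ _
  F_frame E_Theta dE dTheta h h0 cB.
split=> [/defectB hB u|hB]; first by rewrite -bracketE.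
by apply: Bdefect => u; rewrite bracketE.
Qed.

End InChart.

Variable expG : (G -> 'rV[R]_n) -> G.
Hypothesis expG_exp : exponential_map S expG.

(** The exponential curve is an integral curve of a field with constant frame components, so the
    geodesic equation at each instant says that [geodesic_defect] vanishes there. The equivalent
    algebraic condition ignores the instant and the chart: it is read off at time 0 and then holds
    throughout. It no longer involves [c], being the criterion for the Riemannian metric. *)
Lemma geodesic_vectorP h : h != 0 ->
  geodesic_vector S (randers a (lincomb E c)) expG (lincomb E h)
  <-> forall u, dot h (B h u) = 0.
Proof.
move=> h0; have LY : left_invariant_field S (lincomb E h).
  exact: left_invariant_sum.
have Y_neq0 p : lincomb E h p != 0.
  apply: contra_neq h0 => hp0.
  apply: (lincomb_inj a_metric E_on (p := p)); rewrite hp0 lincombE.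
  by rewrite big1// => i _; rewrite mxE scale0r.
have c_sub := expG_exp LY.
set curve := (fun t => expG (t *: lincomb E h)) in c_sub.
have equation phi t : atlas S phi -> dom phi (curve t) ->
    (forall i, derive1n 2 (phi \o curve) t 0 i
      + 2 * spray_coefficient S (randers a (lincomb E c)) phi i
          (phi (curve t)) (derive1 (phi \o curve) t) = 0)
    <-> geodesic_defect S (randers a (lincomb E c)) phi (frame_mx S E phi)
          (phi (curve t)) h = 0.
  move=> Sphi phit; have codx := cod_to_coord Sphi phit.
  have v1 := subgroup_derive1 G_lie LY c_sub Sphi phit.
  have v2 := subgroup_derive2 G_lie LY c_sub Sphi phit.
  rewrite v1 v2 (diff_field_in_lincomb E_smooth h _ Sphi codx).
  rewrite !field_in_lincombE.
  split=> [eq0|defect0 i].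
    apply/rowP => i; rewrite [RHS]mxE -(eq0 i) /geodesic_defect.
    by rewrite [LHS]mxE [X in X + _]mxE [X in _ * X]mxE addrC.
  transitivity (geodesic_defect S (randers a (lincomb E c)) phi
    (frame_mx S E phi) (phi (curve t)) h 0 i); last by rewrite defect0 mxE.
  rewrite /geodesic_defect [RHS]mxE [X in _ = X + _]mxE.
  by rewrite [X in _ = _ * X + _]mxE addrC.
split=> [[_ _ [_ _ geo]]|hB].
  have S1 := atlas_chart_at S (curve 0); have D1 := dom_chart_at S (curve 0).
  have := (equation _ 0 S1 D1).1 (fun i => geo _ 0 i S1 D1).
  by move/(geodesic_defect_in_chart S1 (cod_to_coord S1 D1) h0).
split=> //.
  by move=> Y0; have := Y_neq0 1%g; rewrite Y0 eqxx.
split; first by have [] := c_sub.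
  by move=> t; rewrite (subgroup_velocity G_lie LY c_sub) Y_neq0.
move=> phi t i Sphi phit; move: i.
apply/(equation phi t Sphi phit).
by apply/(geodesic_defect_in_chart Sphi (cod_to_coord Sphi phit) h0).
Qed.

End GeodesicVectors.

(** * The Lie algebra l_{5,9} *)

Lemma lie_bracketC {R : realType} {n : nat} {M : topologicalType}
    (S : smooth_structure R n M) (X Y : M -> 'rV[R]_n) :
  lie_bracket S X Y = - lie_bracket S Y X.
Proof. by apply/funext => p; exact: esym (opprB _ _). Qed.

Lemma lie_bracket_self {R : realType} {n : nat} {M : topologicalType}
    (S : smooth_structure R n M) (X : M -> 'rV[R]_n) : lie_bracket S X X = 0.
Proof. by apply/funext => p; rewrite /lie_bracket subrr. Qed.

(** Lists shorter than five are padded with zeros, the default of [nth 0]; the span cases rely on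
    this. *)
Definition row5 {R : realType} (s : seq R) : 'rV[R]_5 := \row_i s`_i.

(** Passing to a function on [nat] turns the indices into numerals on which lists compute. *)
Lemma sum5 {V : zmodType} (f : 'I_5 -> V) (g : nat -> V) :
  (forall i, f i = g i) -> \sum_i f i = g 0 + g 1 + g 2 + g 3 + g 4.
Proof.
move=> fg; rewrite (eq_bigr (fun i : 'I_5 => g i))//.
by rewrite -(big_mkord xpredT g) /index_iota/= !big_cons big_nil addr0 !addrA.
Qed.
Theorem theorem3p15 (R : realType) (G : groupTopologicalType)
    (S : smooth_structure R 5 G)
    (G_lie : lie_group S)
    (G_simply_connected : simply_connected R G)
    (G_nilpotent : nilpotent_lie_group S)
    (expG : (G -> 'rV[R]_5) -> G)
    (expG_exp : exponential_map S expG)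
    (a : G -> 'rV[R]_5 -> 'rV[R]_5 -> R)
    (a_left_invariant : left_invariant_metric S a)
    (E1 E2 E3 E4 E5 : G -> 'rV[R]_5)
    (E_basis : orthonormal_basis S a [:: E1; E2; E3; E4; E5])
    (k l m p q : R)
    (klmpq : [/\ 0 < k, p < q, 0 < p, 0 <= l & 0 <= m] \/
             [/\ 0 < k, 0 < p, 0 <= l, m = 0 & q = p])
    (E12 : lie_bracket S E1 E2 = k *: E3 + l *: E4 + m *: E5)
    (E13 : lie_bracket S E1 E3 = p *: E4)
    (E14 : lie_bracket S E1 E4 = 0)
    (E15 : lie_bracket S E1 E5 = 0)
    (E23 : lie_bracket S E2 E3 = q *: E5)
    (E24 : lie_bracket S E2 E4 = 0)
    (E25 : lie_bracket S E2 E5 = 0)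
    (E34 : lie_bracket S E3 E4 = 0)
    (E35 : lie_bracket S E3 E5 = 0)
    (E45 : lie_bracket S E4 E5 = 0)
    (X : G -> 'rV[R]_5)
    (X_left_invariant : left_invariant_field S X)
    (X_lt1 : Num.sqrt (lie_dot a X X) < 1)
    (F_douglas : douglas_type S (randers a X))
    (y1 y2 y3 y4 y5 : R) :
  let Y := y1 *: E1 + y2 *: E2 + y3 *: E3 + y4 *: E4 + y5 *: E5 in
  Y <> 0 ->
  geodesic_vector S (randers a X) expG Y <->
  [\/ in_span [:: E3] Y,
      in_span [:: E4; E5] Y,
      in_span [:: E2; E3; E4] Y /\
        y2 * (k * y3 + l * y4) + p * y3 * y4 = 0 |
      [/\ lie_dot a Y E1 <> 0,
          y1 * (k * y3 + l * y4 + m * y5) - q * y3 * y5 = 0 &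
          p * y1 * y4 + q * y2 * y5 = 0]].
Proof.
move=> Y Y0; pose E (i : 'I_5) : G -> 'rV[R]_5 := [:: E1; E2; E3; E4; E5]`_i.
have [E_left E_span E_orth] := E_basis.
have E_left_invariant i : left_invariant_field S (E i) by exact: E_left.
have E_orthonormal i j : lie_dot a (E i) (E j) = (i == j)%:R.
  by rewrite E_orth.
have lincombE5 s : lincomb E (row5 s) =
    s`_0 *: E1 + s`_1 *: E2 + s`_2 *: E3 + s`_3 *: E4 + s`_4 *: E5.
  rewrite /lincomb (sum5 (g := fun i => s`_i *: [:: E1; E2; E3; E4; E5]`_i))//.
  by move=> i; rewrite mxE.
(* Indices start at 0: [d 0 1], [d 0 2] and [d 1 2] are the coefficients of [E1,E2], [E1,E3] and
   [E2,E3]. *)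
pose B (h u : 'rV[R]_5) : 'rV[R]_5 :=
  let d i j := h 0 (inord i) * u 0 (inord j) - h 0 (inord j) * u 0 (inord i) in
  row5 [:: 0; 0; k * d 0%N 1%N; l * d 0%N 1%N + p * d 0%N 2;
    m * d 0%N 1%N + q * d 1%N 2].
have E_bracket h u : lie_bracket S (lincomb E h) (lincomb E u)
    = lincomb E (B h u).
  have E_smooth i : smooth_field S (E i) by have [] := E_left_invariant i.
  rewrite (lie_bracket_lincomb E_smooth) lincombE5/=.
  pose s := [:: E1; E2; E3; E4; E5].
  pose t i j := (h 0 (inord i) * u 0 (inord j)) *: lie_bracket S s`_i s`_j.
  rewrite (sum5 (g := fun i =>
    t i 0%N + t i 1%N + t i 2 + t i 3 + t i 4)); last first.
    by move=> i; apply: (sum5 (g := t i)) => j; rewrite /t !inord_val.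
  rewrite /t /s/= !lie_bracket_self.
  rewrite (lie_bracketC S E2 E1) (lie_bracketC S E3 E1).
  rewrite (lie_bracketC S E4 E1) (lie_bracketC S E5 E1) (lie_bracketC S E3 E2).
  rewrite (lie_bracketC S E4 E2) (lie_bracketC S E5 E2) (lie_bracketC S E4 E3).
  rewrite (lie_bracketC S E5 E3) (lie_bracketC S E5 E4).
  rewrite E12 E13 E14 E15 E23 E24 E25 E34 E35 E45.
  rewrite !(scaler0, oppr0, scale0r, addr0, add0r).
  by apply/funext => g; apply/rowP => j; rewrite /= !fctE !mxE; ring.
have [c XE] : exists c, X = lincomb E c.
  have [c ->] := E_span X X_left_invariant.
  exists (\row_i c i); rewrite /lincomb; apply: eq_bigr => i _.
  by rewrite mxE.
have a_metric : riemannian_metric S a by have [] := a_left_invariant.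
have E_on g i j : a g (E i g) (E j g) = (i == j)%:R.
  by rewrite (left_invariant_dot g a_left_invariant).
have c_lt1 : dot c c < 1.
  have := X_lt1; rewrite XE /lie_dot (metric_lincomb a_metric E_on) => sqrt_lt1.
  by rewrite -(sqr_sqrtr (dot_ge0 c)) expr_lt1 ?sqrtr_ge0.
pose h := row5 [:: y1; y2; y3; y4; y5].
have YE : Y = lincomb E h by rewrite lincombE5.
have h0 : h != 0.
  apply: contra_notN Y0 => /eqP hE; rewrite YE hE /lincomb big1// => i _.
  by rewrite mxE scale0r.
have F_douglas' : douglas_type S (randers a (lincomb E c)) by rewrite -XE.
(* Only three coordinates of [u] occur, because [E4] and [E5] are central. *)
have hB u : dot h (B h u) =
    - (y2 * (k * y3 + l * y4 + m * y5) + p * y3 * y4) * u 0 (inord 0)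
    + (y1 * (k * y3 + l * y4 + m * y5) - q * y3 * y5) * u 0 (inord 1)
    + (p * y1 * y4 + q * y2 * y5) * u 0 (inord 2).
  rewrite dotE (sum5 (g := fun i => h 0 (inord i) * B h u 0 (inord i))).
    by rewrite !mxE !inordK//=; ring.
  by move=> i; rewrite inord_val.
have coord i j : row5 i = row5 j :> 'rV[R]_5 ->
    [/\ i`_0 = j`_0, i`_1 = j`_1, i`_2 = j`_2, i`_3 = j`_3 & i`_4 = j`_4].
  move=> /rowP ij; have ijn n : (n < 5)%N -> i`_n = j`_n.
    by move=> n5; have := ij (Ordinal n5); rewrite !mxE.
  by split; apply: ijn.
have spanP s : lincomb E h = lincomb E (row5 s) ->
    [/\ y1 = s`_0, y2 = s`_1, y3 = s`_2, y4 = s`_3 & y5 = s`_4].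
  move=> hs; apply: (@coord [:: y1; y2; y3; y4; y5]).
  by apply: (lincomb_inj a_metric E_on (p := 1%g)); rewrite -hs.
have q0 : 0 < q by case: klmpq => [[? ? ? _ _]|[? ? _ _ ->]]//; lra.
have YE1 : lie_dot a Y E1 = y1.
  rewrite YE /lie_dot (metric_lincomb_frame a_metric E_on h 1%g ord0).
  by rewrite mxE.
rewrite XE YE1 [Y in geodesic_vector _ _ _ Y]YE.
apply: iff_trans (geodesic_vectorP G_lie a_left_invariant E_left_invariant
  E_orthonormal E_bracket c_lt1 F_douglas' expG_exp h0) _.
split=> [hB0|].
  have hBi i := etrans (esym (hB (delta_mx 0 i))) (hB0 _).
  have e1 : y2 * (k * y3 + l * y4 + m * y5) + p * y3 * y4 = 0.
    have := hBi (inord 0); rewrite !mxE/= -!val_eqE/= !inordK//=; lra.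
  have e2 : y1 * (k * y3 + l * y4 + m * y5) - q * y3 * y5 = 0.
    have := hBi (inord 1); rewrite !mxE/= -!val_eqE/= !inordK//=; lra.
  have e3 : p * y1 * y4 + q * y2 * y5 = 0.
    have := hBi (inord 2); rewrite !mxE/= -!val_eqE/= !inordK//=; lra.
  (* For [y1 = 0] the equations [e2] and [e3] become [q * y3 * y5 = 0] and [q * y2 * y5 = 0] up to
     sign. Since [q] is positive, either [y5 = 0], the third case, or [y2 = y3 = 0], the second.
     Multiples of [E3] come out under the third case. *)
  have [y10|y10] := eqVneq y1 0; last by apply: Or44; split=> //; exact/eqP.
  have [y50|y50] := eqVneq y5 0.
    apply: Or43; split; last by rewrite -e1 y50; ring.
    exists (nth 0 [:: y2; y3; y4]); rewrite !big_ord_recl big_ord0/=.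
    by rewrite /Y y10 y50 !scale0r add0r !addr0 addrA.
  have y30 : y3 = 0.
    apply/eqP; move/eqP: e2.
    by rewrite y10 mul0r sub0r oppr_eq0 !mulf_eq0 (gt_eqF q0) (negbTE y50) orbF.
  have y20 : y2 = 0.
    apply/eqP; move/eqP: e3.
    by rewrite y10 mulr0 mul0r add0r !mulf_eq0 (gt_eqF q0) (negbTE y50) orbF.
  apply: Or42; exists (nth 0 [:: y4; y5]); rewrite !big_ord_recl big_ord0/=.
  by rewrite /Y y10 y20 y30 !scale0r !add0r addr0.
move=> cases u; rewrite hB.
suff [-> -> ->] : [/\ y2 * (k * y3 + l * y4 + m * y5) + p * y3 * y4 = 0,
    y1 * (k * y3 + l * y4 + m * y5) - q * y3 * y5 = 0 &
    p * y1 * y4 + q * y2 * y5 = 0] by ring.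
case: cases => [[s]|[s]|[[s] + e1]|[/eqP y10 e2 e3]].
- rewrite !big_ord_recl big_ord0/= YE => hs.
  have [|-> -> _ -> ->] := spanP [:: 0; 0; s 0%N].
    by rewrite hs lincombE5/= !scale0r !add0r !addr0.
  by split=> /=; ring.
- rewrite !big_ord_recl big_ord0/= YE => hs.
  have [|-> -> -> _ _] := spanP [:: 0; 0; 0; s 0%N; s 1%N].
    by rewrite hs lincombE5/= !scale0r !add0r addr0.
  by split=> /=; ring.
- rewrite !big_ord_recl big_ord0/= YE => hs.
  have [|y10 _ _ _ y50] := spanP [:: 0; s 0%N; s 1%N; s 2%N].
    by rewrite hs lincombE5/= !scale0r !add0r !addr0 addrA.
  (* Here [y5 = 0] cancels the term in [m]. *)
  by rewrite y10 y50/=; split; [apply: etrans _ e1; ring | ring | ring].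
(* [y1] times the missing equation is [y2] times [e2] plus [y3] times [e3]: the two products with
   [q] cancel. *)
- split=> //; apply: (mulfI y10); rewrite mulr0.
  transitivity (y2 * (y1 * (k * y3 + l * y4 + m * y5) - q * y3 * y5)
    + y3 * (p * y1 * y4 + q * y2 * y5)); first by ring.
  by rewrite e2 e3 !mulr0 addr0.
Qed.
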